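(* Let $A\subset\mathbb{R}^n$ be a strictly self-similar fractal with Hausdorff dimension $d$. Then $$\liminf_{p\nearrow d} \frac{\operatorname{Cap}_p(A)^p}{d-p} \ge \frac{\mathcal{H}^d(A)}{d \, \sigma_{d}(A)},$$ where $\sigma_d(A)$ is the constant value taken by the second-order density $\sigma_d(\mathcal{H}^d|_A,x)$ for $\mathcal{H}^d$-almost every $x\in A$.
   Context: Strictly self-similar fractal: a nonempty compact set $A \subset \mathbb{R}^n$ such that $A = \bigcup_{i=1}^N \varphi_i(A)$ for some $N\ge 2$, where $\varphi_i(x) = L_i U_i x + b_i$ with $L_i \in (0,1)$, $U_i$ a unitary (real orthogonal) $n\times n$ matrix and $b_i \in \mathbb{R}^n$, and where the sets $\varphi_1(A),\ldots,\varphi_N(A)$ are (pairwise) disjoint. Known facts recalled by the paper: the Hausdorff dimension $d>0$ of $A$ is determined by $\sum_{i=1}^N L_i^d=1$, and $0<\mathcal{H}^d(A)<\infty$ (Moran); $A$ is Ahlfors $d$-regular, in particular there is $C>0$ with $\mathcal{H}^d(\mathbb{B}^n(x,r)\cap A)\le Cr^d$ for all $x\in A$, $r\in(0,\operatorname{diam}A]$ (Calef); and the second-order density $\sigma_d(\mathcal{H}^d|_A,x)$ exists and is positive, finite and constant for $\mathcal{H}^d$-almost every $x\in A$ (Zähle), so that $\sigma_d(A)$ is well defined. Second-order density at dimension $d$ of a finite Borel measure $\mu$ on $\mathbb{R}^n$: $\sigma_{d}(\mu, x) = \lim_{p\nearrow d} (d-p) \int_0^1 \mu(\mathbb{B}^n(x,r))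 r^{-p-1} \, dr$, provided the limit exists and is finite. Here $\mathbb{B}^n(x,r)$ is the open ball in $\mathbb{R}^n$ with center $x$ and radius $r$, $\mathcal{H}^d$ is $d$-dimensional Hausdorff measure (when $d$ is an integer, normalized to agree with Lebesgue measure on subsets of $\mathbb{R}^d$; the inequality is unaffected by the choice of normalization), and $\mathcal{H}^d|_A(\cdot)=\mathcal{H}^d(\cdot\cap A)$. Riesz energy and capacity: for a nonempty compact set $E\subset\mathbb{R}^n$ and $p>0$, the Riesz $p$-energy is $V_p(E) = \min_\mu \int_E \int_E |x-y|^{-p} \, d\mu(x)\, d\mu(y) \in (0,+\infty]$, where the minimum is over all (Borel) probability measures $\mu$ on $E$ (the minimum is attained, possibly with value $+\infty$). The Riesz $p$-capacity is $\operatorname{Cap}_p(E) = V_p(E)^{-1/p}$, which equals $0$ when $V_p(E)=+\infty$. *)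

(* Defs.v *)
From HB Require Import structures.
From mathcomp Require Import all_boot all_order all_algebra.
From mathcomp Require Import all_classical all_reals all_analysis.

Set Implicit Arguments.
Unset Strict Implicit.
Unset Printing Implicit Defensive.

Import Order.TTheory GRing.Theory Num.Theory.
Import numFieldNormedType.Exports.

Local Open Scope classical_set_scope.
Local Open Scope ring_scope.

(* The library norm and [ball] on matrices come from the sup norm, hence a
   separate Euclidean distance on R^n = 'cV[R]_n. The two induce the same
   topology, so [open] and [compact] below are the library ones. *)
Definition edist (R : realType) (n : nat) (x y : 'cV[R]_n) : R :=
  Num.sqrt (\sum_(i < n) (x i 0 - y i 0) ^+ 2).

Definition oball (R : realType) (n : nat) (x : 'cV[R]_n) (r : R) :
    set 'cV[R]_n :=
  [set y | edist x y < r].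

Definition borel_Rn (R : realType) (n : nat) :=
  g_sigma_algebraType (@open 'cV[R]_n).

Definition similarity (R : realType) (n : nat) (L : R) (U : 'M[R]_n)
    (b x : 'cV[R]_n) : 'cV[R]_n :=
  L *: (U *m x) + b.

Definition strictly_self_similar (R : realType) (n : nat) (A : set 'cV[R]_n) :
    Prop :=
  [/\ A !=set0, compact A &
    exists (N : nat) (L : 'I_N -> R) (U : 'I_N -> 'M[R]_n)
           (b : 'I_N -> 'cV[R]_n),
      [/\ (2 <= N)%N,
          forall i, 0 < L i < 1,
          forall i, U i *m (U i)^T = 1%:M,
          A = \bigcup_i (similarity (L i) (U i) (b i) @` A) &
          trivIset setT (fun i => similarity (L i) (U i) (b i) @` A)]].

Definition diam (R : realType) (n : nat) (E : set 'cV[R]_n) : \bar R :=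
  ereal_sup [set (edist x y)%:E | x in E & y in E].

(* (diam E)^s with 0^0 = 1 (which is what [poweR] gives), except that the
   empty set always has gauge 0; note that [diam set0] is -oo. *)
Definition gauge_diam (R : realType) (n : nat) (s : R) (E : set 'cV[R]_n) :
    \bar R :=
  if E == set0 then 0%E else (diam E `^ s)%E.

Definition hausdorff_content (R : realType) (n : nat) (s delta : R)
    (E : set 'cV[R]_n) : \bar R :=
  ereal_inf [set (\sum_(k <oo) gauge_diam s (F k))%E
    | F in [set F : (set 'cV[R]_n)^nat
        | E `<=` \bigcup_k F k /\ forall k, (diam (F k) <= delta%:E)%E]].

Definition gamma_fun (R : realType) (z : R) : R :=
  \int[@lebesgue_measure R]_(t in `]0, +oo[) (t `^ (z - 1) * expR (- t)).

(* pi^(s/2) / (2^s Gamma(s/2 + 1)): for an integer s, the volume of the ball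
   of diameter 1 in R^s, which makes H^s agree with Lebesgue measure there. *)
Definition hausdorff_const (R : realType) (s : R) : R :=
  pi `^ (s / 2) / (2 `^ s * gamma_fun (s / 2 + 1)).

(* An outer measure, defined on all subsets of R^n. *)
Definition hausdorff_measure (R : realType) (n : nat) (s : R)
    (E : set 'cV[R]_n) : \bar R :=
  ((hausdorff_const s)%:E *
   ereal_sup [set hausdorff_content s delta E
               | delta in [set delta : R | 0 < delta]%R])%E.

Definition hausdorff_dim (R : realType) (n : nat) (E : set 'cV[R]_n) : \bar R :=
  ereal_inf [set s%:E | s in
    [set s : R | 0 <= s /\ hausdorff_measure s E = 0%E]].

Definition has_second_order_density (R : realType) (n : nat) (d : R)
    (mu : set 'cV[R]_n -> \bar R) (x : 'cV[R]_n) (sigma : R) : Prop :=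
  ((d - p)%:E *
    \int[@lebesgue_measure R]_(r in `]0%R, 1%R[)
      (mu (oball x r) * (r `^ (- p - 1))%:E))%E
  @[p --> d^'-] --> sigma%:E.

Definition hausdorff_restr (R : realType) (n : nat) (d : R)
    (A : set 'cV[R]_n) : set 'cV[R]_n -> \bar R :=
  fun E => hausdorff_measure d (E `&` A).

(* sigma_d(A) = sigma: for H^d-almost every x in A the second-order density
   of H^d|_A at x exists and equals sigma. *)
Definition is_second_order_density (R : realType) (n : nat) (d : R)
    (A : set 'cV[R]_n) (sigma : R) : Prop :=
  hausdorff_measure d
    [set x | A x /\
       ~ has_second_order_density d (hausdorff_restr d A) x sigma] = 0%E.

(* Equal to +oo on the diagonal, whereas [powR] has 0 `^ (- p) = 0. *)
Definition riesz_kernel (R : realType) (n : nat) (p : R) (x y : 'cV[R]_n) :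
    \bar R :=
  if x == y then +oo%E else (edist x y `^ (- p))%:E.

Definition riesz_energy (R : realType) (n : nat) (p : R) (E : set 'cV[R]_n) :
    \bar R :=
  ereal_inf [set (\int[mu]_(x in E) \int[mu]_(y in E) riesz_kernel p x y)%E
    | mu in [set mu : probability (borel_Rn R n) R | mu E = 1%E]].

(* For nonempty compact E and p > 0 the energy lies in ]0, +oo]; the case -oo
   does not occur. *)
Definition riesz_capacity (R : realType) (n : nat) (p : R)
    (E : set 'cV[R]_n) : R :=
  if riesz_energy p E is v%:E then v `^ (- p^-1) else 0.

(* Main.v *)
(* Let mu be the restriction of H^d to A, divided by H^d(A). Being a competitor
   in the Riesz energy, mu bounds it from above, and the layer-cake formula
   turns the bound into

     V_p(A) <= 1 + p * \int_A \int_0^1 mu(B(x,r)) r^(-p-1) dr dmu(x).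

   Multiplied by d - p, the inner integral converges mu-almost everywhere to
   sigma / H^d(A) by the definition of second-order density, and it is bounded
   because mu(B(x,r)) <= C r^d; dominated convergence gives
   limsup (d - p) V_p(A) <= d sigma / H^d(A), and Cap_p(A)^p = 1 / V_p(A).

   The facts about H^d come from the disjoint pieces having a positive mutual
   distance e. Iterating the covering of A by its pieces bounds the content of A
   from above, and a set of diameter less than e meets only one piece, which
   bounds it from below; so d is the root of sum_i L_i^d = 1 and
   0 < H^d(A) < oo. For the same reason a ball of radius less than e centered in
   A meets A in a single piece, and rescaling gives mu(B(x,r)) <= C r^d. *)
From HB Require Import structures.
From mathcomp Require Import all_boot all_order all_algebra.
From mathcomp Require Import all_classical all_reals all_analysis.
From mathcomp Require Import measurable_realfun.
From mathcomp Require Import ring lra.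
(* Last, since [edist] is also a name of the library. *)
Require Import Defs.

Set Implicit Arguments.
Unset Strict Implicit.
Unset Printing Implicit Defensive.

Import Order.TTheory GRing.Theory Num.Theory.
Import numFieldNormedType.Exports.

Local Open Scope classical_set_scope.
Local Open Scope ring_scope.

(** * Euclidean distance *)

Section euclidean_distance.
Context (R : realType) (n : nat).
Implicit Types (x y z : 'cV[R]_n).

Lemma edist_ge0 x y : 0 <= edist x y.
Proof. exact: sqrtr_ge0. Qed.

Lemma edistxx x : edist x x = 0.
Proof.
by rewrite /edist big1 ?sqrtr0// => i _; rewrite subrr expr0n.
Qed.

Lemma edistC x y : edist x y = edist y x.
Proof.
by rewrite /edist; congr Num.sqrt; apply: eq_bigr => i _; rewrite -sqrrN opprB.
Qed.

Lemma coord_le_edist x y i : `|x i 0 - y i 0| <= edist x y.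
Proof.
rewrite -sqrtr_sqr ler_wsqrtr// (bigD1 i)//= lerDl.
by apply: sumr_ge0 => j _; exact: sqr_ge0.
Qed.

Lemma edist_eq0 x y : edist x y = 0 -> x = y.
Proof.
move=> xy0; apply/colP => i; apply/eqP; rewrite -subr_eq0 -normr_le0 -xy0.
exact: coord_le_edist.
Qed.

Lemma edist_gt0 x y : x != y -> 0 < edist x y.
Proof.
move=> xy; rewrite lt0r edist_ge0 andbT; apply: contra xy => /eqP/edist_eq0->//.
Qed.

Lemma ler_edistD x y z : edist x z <= edist x y + edist y z.
Proof.
pose a := edist x y; pose b := edist y z.
have sq (u v : 'cV[R]_n) : \sum_i (u i 0 - v i 0) ^+ 2 = edist u v ^+ 2.
  by rewrite sqr_sqrtr//; apply: sumr_ge0 => i _; exact: sqr_ge0.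
have [xy|xy] := eqVneq x y; first by rewrite -/a /a xy edistxx add0r.
have [yz|yz] := eqVneq y z; first by rewrite yz edistxx addr0.
have a0 : 0 < a by exact: edist_gt0.
have b0 : 0 < b by exact: edist_gt0.
rewrite -ler_sqr ?nnegrE ?addr_ge0 ?edist_ge0//.
(* AM-GM coordinatewise: [(s + t)^2 <= (1 + b/a) s^2 + (1 + a/b) t^2] *)
have -> : (edist x y + edist y z) ^+ 2 =
    \sum_i ((1 + b / a) * (x i 0 - y i 0) ^+ 2
            + (1 + a / b) * (y i 0 - z i 0) ^+ 2).
  rewrite big_split/= -!mulr_sumr !sq -/a -/b.
  by field; rewrite !gt_eqF.
rewrite -sq; apply: ler_sum => i _.
set s := x i 0 - y i 0; set t := y i 0 - z i 0.
have -> : x i 0 - z i 0 = s + t by rewrite /s /t; ring.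
rewrite -subr_ge0.
have -> : (1 + b / a) * s ^+ 2 + (1 + a / b) * t ^+ 2 - (s + t) ^+ 2
    = (b * s - a * t) ^+ 2 / (a * b) by field; rewrite !gt_eqF.
by rewrite divr_ge0 ?sqr_ge0// mulr_ge0// ltW.
Qed.

Lemma edist_continuous2 :
  continuous (fun p : 'cV[R]_n * 'cV[R]_n => edist p.1 p.2).
Proof.
move=> p; apply: (@continuous_comp _ _ _
  (fun q : 'cV[R]_n * 'cV[R]_n => \sum_i (q.1 i 0 - q.2 i 0) ^+ 2) Num.sqrt);
  last exact: sqrt_continuous.
apply: cvg_big => [|i _]; first exact: add_continuous.
apply: (@continuous_comp _ _ _
  (fun q : 'cV[R]_n * 'cV[R]_n => q.1 i 0 - q.2 i 0) (fun t : R => t ^+ 2));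
  last exact: exprn_continuous.
apply: cvgB.
- apply: (@continuous_comp _ _ _ fst (fun z : 'cV[R]_n => z i 0)).
    exact: cvg_fst.
  exact: coord_continuous.
- apply: (@continuous_comp _ _ _ snd (fun z : 'cV[R]_n => z i 0)).
    exact: cvg_snd.
  exact: coord_continuous.
Qed.

Lemma edist_continuous x : continuous (edist x).
Proof.
have cx : continuous (fun y : 'cV[R]_n => (x, y)).
  move=> y; have FF : Filter (nbhs y) := nbhs_filter y.
  apply: (@cvg_pair _ _ _ (nbhs y) (nbhs x) (nbhs y) _ _ _ (fun=> x) id) => //.
  exact: cvg_cst.
by move=> y; exact: (continuous_comp (@cx y) (@edist_continuous2 (x, y))).
Qed.

Lemma oball_open x r : open (oball x r).
Proof.
have -> : oball x r = edist x @^-1` [set t | t < r] by [].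
apply: open_comp; last exact: open_lt.
by move=> y _; exact: edist_continuous.
Qed.

(** Library neighbourhoods are sup-norm balls, and a Euclidean ball lies in the sup-norm ball of the
    same radius. *)
Lemma open_oballP (O : set 'cV[R]_n) x : open O -> O x ->
  exists2 r : R, 0 < r & oball x r `<=` O.
Proof.
move=> Oo Ox; have : nbhs x O by exact: open_nbhs_nbhs.
rewrite nbhs_ballP => -[r /= r0 rO]; exists r => // y xy; apply: rO.
split => // i j; rewrite !ord1 /ball/=.
exact: le_lt_trans (coord_le_edist _ _ _) xy.
Qed.

Lemma compact_edist_bounded (A : set 'cV[R]_n) : compact A ->
  exists2 D : R, 0 < D & forall x y, A x -> A y -> edist x y <= D.
Proof.
move=> cA; have [->|/set0P[x0 Ax0]] := eqVneq A set0; first by exists 1.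
have cD : {within A, continuous (edist x0)}.
  by apply: continuous_subspaceT => x; exact: edist_continuous.
have [c _ cmax] := compact_EVT_max (ex_intro _ x0 Ax0) cA cD.
(* [c] is a point of [A] farthest from [x0]; the extra 1 keeps the bound positive when [A] is a
   single point. *)
exists (2 * edist x0 c + 1); first by rewrite ltr_wpDl// mulr_ge0 ?edist_ge0.
move=> x y Ax Ay; apply: le_trans (ler_edistD x x0 y) _.
have := cmax x; have := cmax y; rewrite !inE => /(_ Ay) + /(_ Ax).
by rewrite (edistC x); lra.
Qed.

Lemma compact_edist_separated (A B : set 'cV[R]_n) : compact A -> compact B ->
  A `&` B = set0 ->
  exists2 e : R, 0 < e & forall x y, A x -> B y -> e <= edist x y.
Proof.
move=> cA cB AB0; have [AB|/set0P AB] := eqVneq (A `*` B) set0.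
  by exists 1 => // x y Ax By; have : set0 (x, y) by rewrite -AB.
have cE : {within A `*` B, continuous (fun p => edist p.1 p.2)}.
  by apply: continuous_subspaceT => x; exact: edist_continuous2.
have [[a b] + abmin] := compact_EVT_min AB (compact_setX cA cB) cE.
rewrite inE => -[/= Aa Bb]; exists (edist a b).
  apply: edist_gt0; apply/eqP => ab; have : (A `&` B) a by split=> //; rewrite ab.
  by rewrite AB0.
by move=> x y Ax By; apply: (abmin (x, y)); rewrite inE.
Qed.

Lemma edist_similarity (L : R) (U : 'M[R]_n) b x y : 0 < L ->
  U *m U^T = 1%:M ->
  edist (similarity L U b x) (similarity L U b y) = L * edist x y.
Proof.
move=> L0 UU; rewrite /edist.
have -> : L = Num.sqrt (L ^+ 2) by rewrite sqrtr_sqr gtr0_norm.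
rewrite -sqrtrM ?sqr_ge0// mulr_sumr; congr Num.sqrt.
rewrite sqrtr_sqr gtr0_norm//.
have sq (u : 'cV[R]_n) : \sum_i u i 0 ^+ 2 = (u^T *m u) 0 0.
  by rewrite mxE; apply: eq_bigr => i _; rewrite mxE expr2.
(* Preserving the norm uses [U^T *m U], whereas the hypothesis has the other order. *)
have UTU : U^T *m U = 1%:M by exact: mulmx1C.
have := sq (U *m (x - y)); rewrite trmx_mul mulmxA -(mulmxA _ U^T) UTU mulmx1.
rewrite -sq -mulr_sumr.
have -> : \sum_i (x i 0 - y i 0) ^+ 2 = \sum_i (x - y) i 0 ^+ 2.
  by apply: eq_bigr => i _; rewrite !mxE.
move=> <-; rewrite mulr_sumr; apply: eq_bigr => i _.
by rewrite mulmxBr /similarity !mxE; ring.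
Qed.

End euclidean_distance.

(** * Hausdorff measure as an outer measure *)

Section hausdorff_outer_measure.
Context (R : realType) (n : nat).
Implicit Types (E F : set 'cV[R]_n) (s delta : R).
Local Open Scope ereal_scope.

Lemma edist_le_diam E x y : E x -> E y -> (edist x y)%:E <= diam E.
Proof. by move=> Ex Ey; apply: ereal_sup_ubound; exists x => //; exists y. Qed.

Lemma diam_le E (z : \bar R) :
  (forall x y, E x -> E y -> (edist x y)%:E <= z) -> diam E <= z.
Proof. by move=> Ez; apply: ge_ereal_sup => _ [x Ex [y Ey <-]]; exact: Ez. Qed.

Lemma diam_ge0 E : E !=set0 -> 0 <= diam E.
Proof.
by move=> [x Ex]; rewrite (le_trans _ (edist_le_diam Ex Ex))// lee_fin edist_ge0.
Qed.

Lemma diam0 : diam (@set0 'cV[R]_n) = -oo.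
Proof. by apply/eqP; rewrite -leeNy_eq; apply: diam_le. Qed.

Lemma gauge_diam_ge0 s E : 0 <= gauge_diam s E.
Proof. by rewrite /gauge_diam; case: ifP => // _; exact: poweR_ge0. Qed.

Lemma gauge_diam0 s : gauge_diam s (@set0 'cV[R]_n) = 0.
Proof. by rewrite /gauge_diam eqxx. Qed.

(** Serves both images (ratio [L]) and preimages (ratio [L^-1]) under similarities. Empty sets are
    treated apart, since their gauge is 0 by convention. *)
Lemma le_gauge_diam s E F (L : R) : (0 <= s)%R -> (0 <= L)%R ->
  (E !=set0 -> F !=set0) -> diam E <= L%:E * diam F ->
  gauge_diam s E <= (L `^ s)%:E * gauge_diam s F.
Proof.
move=> s0 L0 EF dEF; have [->|E0] := eqVneq E set0.
  by rewrite gauge_diam0 mule_ge0 ?gauge_diam_ge0// lee_fin powR_ge0.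
have /set0P/EF F0 := E0.
rewrite /gauge_diam (negbTE E0) ifF; last by apply/negbTE/set0P.
rewrite -poweR_EFin -poweRM ?lee_fin ?diam_ge0//.
have dE : 0 <= diam E by exact/diam_ge0/set0P.
by rewrite gt0_ler_poweR// in_itv/= ?leey ?andbT// (le_trans dE).
Qed.

(* With this premeasure, infinite on large sets, the Hausdorff content becomes an
   instance of the library's [mu_ext] over the discrete sigma-algebra. *)
Let capped s delta E := if diam E <= delta%:E then gauge_diam s E else +oo.

Let capped_ge0 s delta E : 0 <= capped s delta E.
Proof. by rewrite /capped; case: ifP => // _; exact: gauge_diam_ge0. Qed.

Let capped0 s delta : capped s delta set0 = 0.
Proof. by rewrite /capped diam0 leNye gauge_diam0. Qed.

Let discrete := g_sigma_algebraType [set: set 'cV[R]_n].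

Lemma hausdorff_content_mu_ext s delta :
  hausdorff_content s delta =
  @mu_ext _ discrete R (capped s delta).
Proof.
have meas (X : set discrete) : measurable X by exact: sub_sigma_algebra.
apply/funext => E; apply/eqP; rewrite eq_le; apply/andP; split.
- apply: le_ereal_inf_tmp => _ [F [_ EF] <-].
  have [dF|] := pselect (forall k, diam (F k) <= delta%:E).
    apply: ereal_inf_lbound; exists F => //; apply: eq_eseriesr => k _.
    by rewrite /capped dF.
  (* A cover with a set larger than [delta] has an infinite [capped] sum, so it cannot lower the
     infimum. *)
  move/existsNP => [k /negP dF]; rewrite (@eseries_pinfty _ _ _ k) ?leey//.
    by move=> m; rewrite -ltNye (lt_le_trans _ (capped_ge0 _ _ _)).
  by rewrite /capped (negbTE dF).
- apply: le_ereal_inf_tmp => _ [F [EF dF] <-].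
  apply: ereal_inf_lbound; exists F => //; apply: eq_eseriesr => k _.
  by rewrite /capped dF.
Qed.

Lemma hausdorff_content_ge0 s delta E : 0 <= hausdorff_content s delta E.
Proof. by rewrite hausdorff_content_mu_ext; exact: mu_ext_ge0. Qed.

Lemma hausdorff_content0 s delta : hausdorff_content s delta (@set0 'cV[R]_n) = 0.
Proof. by rewrite hausdorff_content_mu_ext; exact: mu_ext0. Qed.

Lemma le_hausdorff_content s delta :
  {homo @hausdorff_content R n s delta : E F / E `<=` F >-> E <= F}.
Proof. by rewrite hausdorff_content_mu_ext; exact: (@le_mu_ext _ discrete). Qed.

Lemma hausdorff_content_sigma_subadditive s delta :
  sigma_subadditive (@hausdorff_content R n s delta).
Proof.
rewrite hausdorff_content_mu_ext.
exact: (@mu_ext_sigma_subadditive _ discrete).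
Qed.

HB.instance Definition _ s delta := isOuterMeasure.Build R 'cV[R]_n
  (@hausdorff_content R n s delta) (hausdorff_content0 s delta)
  (hausdorff_content_ge0 s delta) (@le_hausdorff_content s delta)
  (@hausdorff_content_sigma_subadditive s delta).

Lemma hausdorff_content_le_delta s delta delta' E : (delta <= delta')%R ->
  hausdorff_content s delta' E <= hausdorff_content s delta E.
Proof.
move=> dd; apply: ereal_inf_le_tmp => _ [F [EF dF] <-]; exists F => //.
by split=> // k; rewrite (le_trans (dF k))// lee_fin.
Qed.

Lemma gamma_fun_ge0 (z : R) : (0 <= gamma_fun z)%R.
Proof.
by apply: Rintegral_ge0 => t _; rewrite mulr_ge0 ?powR_ge0 ?expR_ge0.
Qed.

Lemma hausdorff_const_ge0 s : (0 <= hausdorff_const s)%R.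
Proof. by rewrite /hausdorff_const divr_ge0 ?mulr_ge0 ?powR_ge0 ?gamma_fun_ge0. Qed.

Lemma hausdorff_content_le_sup s delta E : (0 < delta)%R ->
  hausdorff_content s delta E <=
  ereal_sup [set hausdorff_content s t E | t in [set t : R | 0 < t]%R].
Proof. by move=> d0; apply: ereal_sup_ubound; exists delta. Qed.

Lemma hausdorff_content_sup_ge0 s E :
  0 <= ereal_sup [set hausdorff_content s t E | t in [set t : R | 0 < t]%R].
Proof.
by rewrite (le_trans _ (hausdorff_content_le_sup _ _ (@ltr01 R)))//
  hausdorff_content_ge0.
Qed.

Lemma hausdorff_measure_ge0 s E : 0 <= hausdorff_measure s E.
Proof.
by rewrite mule_ge0 ?hausdorff_content_sup_ge0// lee_fin hausdorff_const_ge0.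
Qed.

Lemma hausdorff_measure0 s : hausdorff_measure s (@set0 'cV[R]_n) = 0.
Proof.
rewrite /hausdorff_measure (_ : [set _ | _ in _] = [set 0]).
  by rewrite ereal_sup1 mule0.
apply/seteqP; split=> [_ [t _ <-]|_ ->]; first exact: hausdorff_content0.
by exists 1%R; [exact: ltr01|exact: hausdorff_content0].
Qed.

Lemma le_hausdorff_measure s :
  {homo @hausdorff_measure R n s : E F / E `<=` F >-> E <= F}.
Proof.
move=> E F EF; apply: lee_wpmul2l; first by rewrite lee_fin hausdorff_const_ge0.
apply: ge_ereal_sup => _ [t /= t0 <-].
by apply: le_trans (hausdorff_content_le_sup s F t0); exact: le_hausdorff_content.
Qed.

Lemma hausdorff_measure_sigma_subadditive s :
  sigma_subadditive (@hausdorff_measure R n s).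
Proof.
move=> F; rewrite nneseriesZl ?lee_fin ?hausdorff_const_ge0//; last first.
  by move=> i _; exact: hausdorff_content_sup_ge0.
apply: lee_wpmul2l; first by rewrite lee_fin hausdorff_const_ge0.
apply: ge_ereal_sup => _ [t /= t0 <-].
apply: le_trans (hausdorff_content_sigma_subadditive s t F) _.
apply: lee_nneseries => i _ ; first by move=> _; exact: hausdorff_content_ge0.
exact: hausdorff_content_le_sup.
Qed.

HB.instance Definition _ s := isOuterMeasure.Build R 'cV[R]_n
  (@hausdorff_measure R n s) (hausdorff_measure0 s)
  (hausdorff_measure_ge0 s) (@le_hausdorff_measure s)
  (@hausdorff_measure_sigma_subadditive s).

(** The images of the sets of a cover form a cover of the image, with diameters multiplied by at
    most [L]. *)
Lemma hausdorff_content_scale s delta E (f : 'cV[R]_n -> 'cV[R]_n) (L : R) :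
  (0 <= s)%R -> (0 < L)%R ->
  (forall x y, edist (f x) (f y) = L * edist x y)%R ->
  hausdorff_content s (L * delta) (f @` E) <=
  (L `^ s)%:E * hausdorff_content s delta E.
Proof.
move=> s0 L0 fL; have Ls0 : (0 < L `^ s)%R by exact: powR_gt0.
rewrite -lee_pdivrMl//; apply: le_ereal_inf_tmp => _ [F [EF dF] <-].
rewrite lee_pdivrMl// -nneseriesZl ?lee_fin ?(ltW Ls0)//; last first.
  by move=> k _; exact: gauge_diam_ge0.
have dfF k : diam (f @` F k) <= L%:E * diam (F k).
  apply: diam_le => _ _ [x Fx <-] [y Fy <-]; rewrite fL EFinM.
  by rewrite lee_pmul2l// edist_le_diam.
apply: (@le_trans _ _ (\sum_(k <oo) gauge_diam s (f @` F k))).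
  apply: ereal_inf_lbound; exists (fun k => f @` F k) => //; split.
    by move=> _ [x /EF[k _ Fx] <-]; exists k => //; exists x.
  by move=> k; rewrite (le_trans (dfF k))// EFinM lee_pmul2l.
apply: lee_nneseries => k _; first by move=> _; exact: gauge_diam_ge0.
apply: le_gauge_diam => //; first exact: ltW.
by move=> [_ [x Fx _]]; exists x.
Qed.

Lemma hausdorff_measure_scale s E (f : 'cV[R]_n -> 'cV[R]_n) (L : R) :
  (0 <= s)%R -> (0 < L)%R ->
  (forall x y, edist (f x) (f y) = L * edist x y)%R ->
  hausdorff_measure s (f @` E) <= (L `^ s)%:E * hausdorff_measure s E.
Proof.
move=> s0 L0 fL; rewrite muleCA; apply: lee_wpmul2l.
  by rewrite lee_fin hausdorff_const_ge0.
apply: ge_ereal_sup => _ [t /= t0 <-].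
rewrite -[t](mulfVK (lt0r_neq0 L0)) mulrC.
apply: le_trans (hausdorff_content_scale _ _ s0 L0 fL) _.
rewrite lee_pmul2l ?lte_fin ?powR_gt0//.
by apply: hausdorff_content_le_sup; rewrite divr_gt0.
Qed.

(* No set of diameter below [eta] meets both [E] and [F]. *)
Lemma hausdorff_content_separated s delta E F (eta : R) : (delta < eta)%R ->
  (forall x y, E x -> F y -> eta <= edist x y)%R ->
  hausdorff_content s delta E + hausdorff_content s delta F <=
  hausdorff_content s delta (E `|` F).
Proof.
move=> de EFe; apply: le_ereal_inf_tmp => _ [G [EFG dG] <-].
pose GE k := if `[< G k `&` E !=set0 >] then G k else set0.
pose GF k := if `[< G k `&` E !=set0 >] then set0 else G k.
have -> : \sum_(k <oo) gauge_diam s (G k) =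
    \sum_(k <oo) gauge_diam s (GE k) + \sum_(k <oo) gauge_diam s (GF k).
  rewrite -nneseriesD//; try by move=> k _ _; exact: gauge_diam_ge0.
  apply: eq_eseriesr => k _; rewrite /GE /GF.
  by case: asboolP => _; rewrite gauge_diam0 ?adde0 ?add0e.
apply: leeD; apply: ereal_inf_lbound.
- exists GE => //; split=> [x Ex|k].
    have [k _ Gx] := EFG x (or_introl Ex); exists k => //.
    by rewrite /GE ifT//; apply/asboolP; exists x.
  by rewrite /GE; case: ifP => // _; rewrite diam0 leNye.
- exists GF => //; split=> [x Fx|k].
    have [k _ Gx] := EFG x (or_intror Fx); exists k => //.
    rewrite /GF ifF//; apply/asboolP => -[y [Gy Ey]].
    have := le_trans (edist_le_diam Gy Gx) (dG k); rewrite lee_fin leNgt.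
    by rewrite (lt_le_trans de)// EFe.
  by rewrite /GF; case: ifP => // _; rewrite diam0 leNye.
Qed.

(** Additivity on separated sets, the property of a metric outer measure; it later yields
    Caratheodory measurability. *)
Lemma hausdorff_measure_separated s E F (eta : R) : (0 < eta)%R ->
  (forall x y, E x -> F y -> eta <= edist x y)%R ->
  hausdorff_measure s E + hausdorff_measure s F <=
  hausdorff_measure s (E `|` F).
Proof.
move=> eta0 EFe; rewrite /hausdorff_measure -ge0_muleDr ?hausdorff_content_sup_ge0//.
apply: lee_wpmul2l; first by rewrite lee_fin hausdorff_const_ge0.
set C := ereal_sup [set hausdorff_content s t (_ `|` _) | t in _].
(* Contents grow as the scale shrinks, so [a] and [b] can be replaced by a common scale below [eta].
   Independent scales let the two suprema be taken one after the other. *)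
have key (a b : R) : (0 < a)%R -> (0 < b)%R ->
    hausdorff_content s a E + hausdorff_content s b F <= C.
  move=> a0 b0; pose t := Num.min (Num.min a b) (eta / 2)%R.
  have t0 : (0 < t)%R by rewrite !lt_min a0 b0 divr_gt0.
  have te : (t < eta)%R.
    by rewrite gt_min; apply/orP; right; rewrite ltr_pdivrMr// ltr_pMr// ltr1n.
  apply: le_trans (hausdorff_content_le_sup s (E `|` F) t0).
  apply: le_trans (hausdorff_content_separated _ te EFe).
  by apply: leeD; apply: hausdorff_content_le_delta; rewrite !ge_min lexx ?orbT.
have [->|Cy] := eqVneq C +oo; first by rewrite leey.
have Coo : C < +oo by rewrite lt_neqAle Cy leey.
have bfin b : (0 < b)%R -> hausdorff_content s b F \is a fin_num.
  move=> b0; rewrite ge0_fin_numE ?hausdorff_content_ge0//.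
  rewrite (le_lt_trans _ Coo)// (le_trans _ (key b b b0 b0))//.
  by rewrite leeDr// hausdorff_content_ge0.
have Efin : ereal_sup [set hausdorff_content s t E | t in [set t : R | 0 < t]%R]
    \is a fin_num.
  rewrite ge0_fin_numE ?hausdorff_content_sup_ge0// (le_lt_trans _ Coo)//.
  apply: ge_ereal_sup => _ [t /= t0 <-].
  by rewrite (le_trans _ (key t t t0 t0))// leeDl// hausdorff_content_ge0.
rewrite -leeBrDl//; apply: ge_ereal_sup => _ [b /= b0 <-].
rewrite leeBrDl// -leeBrDr ?bfin//; apply: ge_ereal_sup => _ [a /= a0 <-].
by rewrite leeBrDr ?bfin// key.
Qed.

End hausdorff_outer_measure.

(** * Positivity of the normalizing constant *)

Section gamma.
Context (R : realType).
Local Notation leb := (@lebesgue_measure R).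

(** Raise [t <= c * expR (t / c)] to the power [a]; the choice [c = 2 * (a + 1)] ensures
    [a / c <= 1 / 2]. *)
Lemma powR_le_expR (a t : R) : 0 <= a -> 0 < t ->
  t `^ a <= (2 * (a + 1)) `^ a * expR (t / 2).
Proof.
move=> a0 t0; set c := 2 * (a + 1).
have c0 : 0 < c by rewrite mulr_gt0// ltr_wpDl.
have tc : t <= c * expR (t / c).
  rewrite -ler_pdivrMl// [_^-1 * t]mulrC.
  apply: (@le_trans _ _ (1 + t / c)); last exact: expR_ge1Dx.
  by rewrite lerDr ler01.
apply: (@le_trans _ _ ((c * expR (t / c)) `^ a)).
  apply: ge0_ler_powR => //; rewrite nnegrE; first exact: ltW.
  by rewrite mulr_ge0 ?expR_ge0// ltW.
rewrite powRM ?expR_ge0 ?(ltW c0)// ler_wpM2l ?powR_ge0//.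
rewrite -expRM ler_expR -mulrA ler_wpM2l ?(ltW t0)//.
by rewrite ler_pdivrMl// /c; lra.
Qed.

Lemma measurable_gamma_integrand (z : R) :
  measurable_fun [set: R] (fun t : R => t `^ (z - 1) * expR (- t)).
Proof.
apply: measurable_funM; first exact: measurable_powR.
by apply: measurableT_comp => //; exact: measurableT_comp.
Qed.

Lemma integrable_gamma (z : R) : 1 <= z ->
  leb.-integrable `]0, +oo[ (fun t => (t `^ (z - 1) * expR (- t))%:E).
Proof.
(* The constant of [powR_le_expR] at [a = z - 1], doubled to cancel the rate 1/2 in front of the
   dominating exponential density. *)
move=> z1; pose K := 2 * (2 * (z - 1 + 1)) `^ (z - 1).
have h0 : (0 < 2^-1 :> R) by rewrite invr_gt0.
have iE : leb.-integrable `]0, +oo[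
    (fun t => (K%:E * (exponential_pdf (2^-1) t)%:E)%E).
  apply: integrableZl => //.
  by apply: integrableS (integrable_exponential_pdf h0).
apply: le_integrable iE => //.
  by apply/measurable_EFinP/measurable_funTS; exact: measurable_gamma_integrand.
move=> t /=; rewrite in_itv/= andbT => t0.
rewrite lee_fin ger0_norm ?mulr_ge0 ?powR_ge0 ?expR_ge0//.
rewrite (le_trans _ (ler_norm _))// exponential_pdfE ?(ltW t0)//.
have := powR_le_expR (_ : 0 <= z - 1) t0; rewrite subr_ge0 => /(_ z1) tz.
apply: le_trans (ler_wpM2r (expR_ge0 _) tz) _.
rewrite -mulrA -expRD /K; set A := _ `^ _.
rewrite (_ : t / 2 - t = - 2^-1 * t); last by lra.
by rewrite le_eqVlt; apply/orP; left; apply/eqP; field.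
Qed.

(** A real-valued integral defaults to 0 when infinite, so finiteness is needed besides a positive
    lower bound. On [[1, 2]] the integrand is at least [expR (- 2)]. *)
Lemma gamma_fun_gt0 (z : R) : 1 <= z -> 0 < gamma_fun z.
Proof.
move=> z1; rewrite fine_gt0//; apply/andP; split; last first.
  exact: integrable_lty (integrable_gamma z1).
have mG : measurable_fun [set: R] (fun t => (t `^ (z - 1) * expR (- t))%:E).
  by apply/measurable_EFinP; exact: measurable_gamma_integrand.
have e0 : (0 < (expR (- 2 : R))%:E)%E by rewrite lte_fin expR_gt0.
apply: (lt_le_trans e0).
apply: (@le_trans _ _ (\int[leb]_(t in `[1%R, 2%R]) (expR (- 2))%:E)%E).
  rewrite (integral_cst leb _ (expR (- 2))%:E)//= lebesgue_measure_itv/= lte_fin.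
  rewrite ltr1n -EFinD -EFinM lee_fin.
  by rewrite (_ : 2 - 1 = 1 :> R) ?mulr1//; ring.
have sub : [set` `[1, 2]] `<=` [set` `]0 : R, +oo[].
  by move=> t /=; rewrite !in_itv/= andbT => /andP[t1 _]; exact: lt_le_trans t1.
apply: (@le_trans _ _ (\int[leb]_(t in `[1%R, 2%R]) (t `^ (z - 1) * expR (- t))%:E)%E).
  apply: ge0_le_integral => //.
  - exact: measurable_funTS.
  - move=> t /=; rewrite in_itv/= => /andP[t1 t2]; rewrite lee_fin.
    rewrite -[leLHS]mul1r ler_pM ?ler01 ?expR_ge0 ?ler_expR ?lerN2//.
    by rewrite -[leLHS](powRr0 t) ler_powR// subr_ge0.
apply: ge0_subset_integral => //.
  exact: measurable_funTS.
by move=> t _; rewrite lee_fin mulr_ge0 ?powR_ge0 ?expR_ge0.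
Qed.

Lemma hausdorff_const_gt0 (s : R) : 0 <= s -> 0 < hausdorff_const s.
Proof.
move=> s0; rewrite /hausdorff_const divr_gt0 ?mulr_gt0 ?powR_gt0 ?pi_gt0//.
by apply: gamma_fun_gt0; rewrite lerDr divr_ge0.
Qed.

End gamma.

(** * Finite covers *)

Lemma outer_measure_bigcup_fin (R : realType) (T : Type) (I : finType)
    (mu : {outer_measure set T -> \bar R}) (F : I -> set T) :
  (mu (\bigcup_i F i) <= \sum_i mu (F i))%E.
Proof.
have -> : \bigcup_i F i = \big[setU/set0]_(i <- index_enum I) F i.
  rewrite -bigcup_seq; apply: eq_bigcupl; split=> i //= _.
  by rewrite mem_index_enum.
elim: (index_enum I) => [|i s IH]; first by rewrite !big_nil outer_measure0.
rewrite !big_cons (le_trans (outer_measureU2 _ _ _))//.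
by rewrite leeD2l.
Qed.

Section inflation.
Context (R : realType) (n : nat).
Implicit Types (E F : set 'cV[R]_n).

(** [G] is the union of the balls of radius [r] around the points of [E], which raises the diameter
    by at most [2 * r]. *)
Lemma gauge_diam_inflate (t delta eps : R) E : 0 <= t -> 0 < eps ->
  (diam E <= delta%:E)%E ->
  exists G, [/\ open G, E `<=` G &
    (gauge_diam t G <= gauge_diam t E + eps%:E)%E].
Proof.
move=> t0 eps0 dE; have [->|E0] := eqVneq E set0.
  exists set0; split; [exact: open0|by []|].
  by rewrite leeDl// lee_fin ltW.
have /set0P[x0 Ex0] := E0.
have [a dEa] : exists a : R, diam E = a%:E.
  have := diam_ge0 (ex_intro _ x0 Ex0); move: dE.
  by case: (diam E) => // a _ _; exists a.
have a0 : 0 <= a by rewrite -lee_fin -dEa; apply: diam_ge0; exists x0.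
(* The diameter allowed for [G]: if [t = 0] all powers are 1 and any [b > a] works; otherwise [b] is
   the [t]-th root of [a^t + eps]. *)
have [b ab bt] : exists2 b, a < b & b `^ t <= a `^ t + eps.
  have [->|t_neq0] := eqVneq t 0.
    by exists (a + 1); rewrite ?ltrDl// !powRr0 lerDl ltW.
  have tgt0 : 0 < t by rewrite lt0r t_neq0.
  have p0 : 0 <= a `^ t + eps by rewrite addr_ge0 ?powR_ge0 ?ltW.
  exists ((a `^ t + eps) `^ t^-1); last by rewrite -powRrM mulVf// powRr1.
  have {1}-> : a = (a `^ t) `^ t^-1 by rewrite -powRrM divff// powRr1.
  by rewrite gt0_ltr_powR ?invr_gt0// ?nnegrE ?powR_ge0// ltrDl.
pose r := (b - a) / 2.
have r0 : 0 < r by rewrite divr_gt0// subr_gt0.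
pose G := \bigcup_(x in E) oball x r; exists G; split.
- by apply: bigcup_open => x _; exact: oball_open.
- by move=> x Ex; exists x => //; rewrite /oball/= edistxx.
have Gx0 : G x0 by exists x0 => //; rewrite /oball/= edistxx.
rewrite /gauge_diam ifF; last by apply/negbTE/set0P; exists x0.
rewrite (negbTE E0) dEa poweR_EFin -EFinD.
apply: (@le_trans _ _ (b `^ t)%:E); last by rewrite lee_fin.
rewrite -poweR_EFin; have dGb : (diam G <= b%:E)%E.
  apply: diam_le => y z [u Eu uy] [v Ev vz].
  have := edist_le_diam Eu Ev; rewrite dEa !lee_fin => uv.
  have := ler_edistD y u z; have := ler_edistD u v z; rewrite (edistC y u).
  move: uy vz; rewrite /oball/= /r; lra.
rewrite gt0_ler_poweR// in_itv/= ?leey ?andbT ?lee_fin.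
- by apply: diam_ge0; exists x0.
- by rewrite (le_trans a0)// ltW.
Qed.

(** Enlarging the [k]-th set of a countable cover to an open one, at cost [e / 2^(k+1)], lets
    compactness extract a finite cover. Finite covers carry no diameter bound because the enlarged
    sets may exceed [delta]. *)
Lemma hausdorff_content_ge_finite_cover (t delta c : R) E : 0 <= t ->
  compact E ->
  (forall s : seq (set 'cV[R]_n),
    E `<=` \bigcup_(G in [set` s]) G ->
    (c%:E <= \sum_(G <- s) gauge_diam t G)%E) ->
  (c%:E <= hausdorff_content t delta E)%E.
Proof.
move=> t0 cE Hc; apply: le_ereal_inf_tmp => _ [F [EF dF] <-].
apply/lee_addgt0Pr => e e0.
have /choice[G HG] : forall k, exists G, [/\ open G, F k `<=` G &
    (gauge_diam t G <= gauge_diam t (F k) + (e / (2 ^ k.+1)%:R)%:E)%E].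
  move=> k; apply: gauge_diam_inflate (dF k) => //.
  by rewrite divr_gt0// ltr0n expn_gt0.
have : cover_compact E by rewrite -compact_cover.
move=> /(_ nat setT G)[k _|x /EF[k _ Fx]|D _ ED].
- by case: (HG k).
- by exists k => //; have [_ + _] := HG k; apply.
(* Keeping all indices below [M], not only those in [D], makes the finite sum a partial sum of the
   series. *)
pose M := (\max_(k <- finmap.enum_fset D) k.+1)%N.
have EM : E `<=` \bigcup_(X in [set` [seq G k | k <- iota 0 M]]) X.
  move=> x /ED[k /= kD Gx]; exists (G k) => //=.
  apply/mapP; exists k => //; rewrite mem_iota/= add0n.
  exact: (@leq_bigmax_seq _ _ xpredT (fun k => k.+1) k kD isT).
apply: le_trans (Hc _ EM) _; rewrite big_map.
apply: le_trans (epsilon_trick xpredT _ (ltW e0)); last first.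
  by move=> k; exact: gauge_diam_ge0.
apply: le_trans (nneseries_lim_ge M _); last first.
  by move=> k _ _; rewrite adde_ge0 ?gauge_diam_ge0// lee_fin divr_ge0 ?ltW.
rewrite /index_iota subn0; apply: lee_sum => k _.
by case: (HG k).
Qed.

End inflation.

(** * Self-similar sets *)

Lemma exists_ratio_pow_lt (R : realType) (rho D r : R) : 0 < rho < 1 -> 0 < D -> 0 < r ->
  exists m, rho ^+ m * D < r.
Proof.
move=> /andP[rho0 rho1] D0 r0.
have : rho ^+ k * D @[k --> \oo] --> 0.
  rewrite -[X in _ --> X](mul0r D); apply: cvgM; last exact: cvg_cst.
  by apply: cvg_expr; rewrite ger0_norm// ltW.
move/cvgrPdist_lt => /(_ _ r0)[m _ H]; have := H m (leqnn m); rewrite /=.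
by rewrite sub0r normrN => rm; exists m; exact: le_lt_trans (ler_norm _) rm.
Qed.

(** What the later arguments retain of strict self-similarity: exact scaling of distances, and
    disjointness in the quantitative form of a common gap [e]. *)
Record separated_ifs (R : realType) (n N : nat) (A : set 'cV[R]_n)
    (L : 'I_N -> R) (f : 'I_N -> 'cV[R]_n -> 'cV[R]_n) (e : R) : Prop := {
  ifs_nonempty : A !=set0 ;
  ifs_compact : compact A ;
  ifs_ge2 : (2 <= N)%N ;
  ifs_ratio : forall i, 0 < L i < 1 ;
  ifs_scale : forall i x y, edist (f i x) (f i y) = L i * edist x y ;
  ifs_cover : A = \bigcup_i f i @` A ;
  ifs_gap_gt0 : 0 < e ;
  ifs_gap : forall i j x y, i != j -> A x -> A y -> e <= edist (f i x) (f j y) }.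

Definition moran (R : realType) (N : nat) (L : 'I_N -> R) (t : R) : R :=
  \sum_i L i `^ t.

Lemma strictly_self_similar_ifs (R : realType) (n : nat) (A : set 'cV[R]_n) :
  strictly_self_similar A ->
  exists N (L : 'I_N -> R) f e, separated_ifs A L f e.
Proof.
move=> [A0 cA [N [L [U [b [N2 L01 UU AE tA]]]]]].
pose f i := similarity (L i) (U i) (b i).
have fL i x y : edist (f i x) (f i y) = L i * edist x y.
  by have /andP[L0 _] := L01 i; apply: edist_similarity.
have fcont i : continuous (f i).
  move=> x W /=; rewrite nbhsE => -[V [Vo Vfx] VW].
  have [r r0 rV] := open_oballP Vo Vfx; have /andP[L0 _] := L01 i.
  rewrite nbhs_simpl nbhsE; exists (oball x (r / L i)).
    split; first exact: oball_open.
    by rewrite /oball/= edistxx divr_gt0.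
  move=> y xy; apply/VW/rV; rewrite /oball/= fL mulrC -ltr_pdivlMr//.
have cf i : compact (f i @` A).
  by apply: continuous_compact => //; exact: continuous_subspaceT.
have [e e0 He] : exists2 e : R, 0 < e & forall i j x y, i != j -> A x -> A y ->
    e <= edist (f i x) (f j y).
  (* Disjoint compact pieces are a positive distance apart, and there are finitely many pairs; equal
     indices get the dummy value 1. *)
  have sep (p : 'I_N * 'I_N) : exists e : R, 0 < e /\ (p.1 != p.2 ->
      forall x y, A x -> A y -> e <= edist (f p.1 x) (f p.2 y)).
    have [ij|ij] := boolP (p.1 == p.2); first by exists 1; split.
    have dis : f p.1 @` A `&` f p.2 @` A = set0.
      by move/trivIsetP : tA; apply.
    have [e e0 He] := compact_edist_separated (cf p.1) (cf p.2) dis.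
    by exists e; split => // _ x y Ax Ay; apply: He; [exists x|exists y].
  have [e He] := choice sep.
  exists (\big[Num.min/1]_p e p).
    elim/big_ind : _ => // [x y x0 y0|p _]; first by rewrite lt_min x0.
    by have [] := He p.
  move=> i j x y ij Ax Ay; apply: (@le_trans _ _ (e (i, j))).
    exact: bigmin_le.
  by have [_ +] := He (i, j); apply.
by exists N, L, f, e; split.
Qed.

(** * Moran's equation for the contraction ratios *)

Section moran_function.
Context (R : realType) (N : nat) (L : 'I_N -> R).
Hypotheses (N2 : (2 <= N)%N) (L01 : forall i, 0 < L i < 1).

Lemma max_ratio : exists2 rho : R, 0 < rho < 1 & forall i, L i <= rho.
Proof.
pose i0 : 'I_N := Ordinal (ltnW N2).
exists (\big[Num.max/L i0]_i L i); last by move=> i; exact: le_bigmax.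
apply/andP; split.
  apply: lt_le_trans (le_bigmax _ _ i0).
  by have /andP[] := L01 i0.
elim/big_ind : _ => // [|x y x1 y1|i _]; last by have /andP[] := L01 i.
  by have /andP[] := L01 i0.
by rewrite gt_max x1.
Qed.

Lemma moran_ge0 t : 0 <= moran L t.
Proof. by apply: sumr_ge0 => i _; exact: powR_ge0. Qed.

Let Lexp i t : L i `^ t = expR (t * ln (L i)).
Proof. by rewrite /powR gt_eqF//; have /andP[] := L01 i. Qed.

Lemma moran_decreasing s t : s < t -> moran L t < moran L s.
Proof.
move=> st; pose i0 : 'I_N := Ordinal (ltnW N2).
rewrite /moran; apply: ltr_sum => [|i _]; first by apply/hasP; exists i0.
by rewrite !Lexp ltr_expR ltr_nM2r// ln_lt0.
Qed.

Lemma moran_continuous : continuous (moran L).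
Proof.
have cL i : continuous (fun t => L i `^ t).
  rewrite (_ : (fun t => _) = expR \o (fun t => t * ln (L i))); last first.
    by apply/funext => u; exact: Lexp.
  move=> t; apply: continuous_comp; last exact: continuous_expR.
  by apply: cvgM; [exact: cvg_id|exact: cvg_cst].
by move=> t; apply: cvg_big => [|i _]; [exact: add_continuous|exact: cL].
Qed.

Lemma moran_root : exists2 s, 0 < s & moran L s = 1.
Proof.
have [rho /andP[rho0 rho1] Lrho] := max_ratio.
have N0 : 0 < N%:R :> R by rewrite ltr0n (ltnW N2).
(* Chosen so that [N * rho^T = 1], whence [moran L T <= 1]; at 0 the value is [N > 1], and the
   intermediate value theorem gives the root. *)
pose T := ln N%:R / - ln rho.
have T0 : 0 <= T.
  rewrite divr_ge0 ?oppr_ge0 ?ln_le0 ?(ltW rho1)//.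
  by rewrite ln_ge0// ler1n (ltnW N2).
have m0 : 1 < moran L 0.
  rewrite /moran (eq_bigr (fun=> 1)); last by move=> i _; rewrite powRr0.
  by rewrite sumr_const card_ord ltr1n.
have mT : moran L T <= 1.
  apply: (@le_trans _ _ (\sum_(i < N) N%:R^-1)); last first.
    by rewrite sumr_const card_ord -(mulr_natr N%:R^-1) mulVf// gt_eqF.
  apply: ler_sum => i _.
  apply: (@le_trans _ _ (rho `^ T)).
    by apply: ge0_ler_powR => //; rewrite ?nnegrE ?ltW//; have /andP[] := L01 i.
  rewrite /powR gt_eqF// /T invrN mulrN mulNr divfK; last first.
    by rewrite lt_eqF// ln_lt0// rho0.
  by rewrite expRN lnK.
have := @IVT R (moran L) 0 T 1 T0.
case=> [||s].
- by apply: continuous_subspaceT => x; exact: moran_continuous.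
- by rewrite ge_min le_max mT orbT (ltW m0).
rewrite in_itv/= => /andP[s0 _] ms; exists s => //.
rewrite lt0r s0 andbT; apply/eqP => s00.
by move: m0; rewrite -s00 ms ltxx.
Qed.

End moran_function.

(** * Dimension and Hausdorff measure of a self-similar set *)

Section self_similar_measure.
Context (R : realType) (n N : nat) (A : set 'cV[R]_n) (L : 'I_N -> R)
  (f : 'I_N -> 'cV[R]_n -> 'cV[R]_n) (e : R).
Hypothesis S : separated_ifs A L f e.

Let L0 i : 0 < L i. Proof. by have /andP[] := ifs_ratio S i. Qed.

Let fA i x : A x -> A (f i x).
Proof. by move=> Ax; rewrite (ifs_cover S); exists i => //; exists x. Qed.

Let e0 := ifs_gap_gt0 S.

(** Induction on generations: covering [A] by its pieces and rescaling multiplies the scale by at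
    most [rho] and the bound by [moran L t]. At [m = 0] the cover is [A] itself. *)
Lemma hausdorff_content_moran_pow (rho D t : R) m :
  (forall i, L i <= rho) -> 0 < rho -> 0 < D -> 0 <= t ->
  (forall x y, A x -> A y -> edist x y <= D) ->
  (hausdorff_content t (rho ^+ m * D) A <= (moran L t ^+ m * D `^ t)%:E)%E.
Proof.
move=> Lrho rho0 D0 t0 AD.
have dA : (diam A <= D%:E)%E.
  by apply: diam_le => x y Ax Ay; rewrite lee_fin AD.
elim: m => [|m IH].
  rewrite !expr0 !mul1r.
  pose F k : set 'cV[R]_n := if k is 0%N then A else set0.
  apply: (@le_trans _ _ (\sum_(k <oo) gauge_diam t (F k))%E).
    apply: ereal_inf_lbound; exists F => //.
    split; first by move=> x Ax; exists 0%N.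
    case=> [|k]; first exact: dA.
    by rewrite /F/= diam0; exact: leNye.
  rewrite nneseries_recl //; last by move=> *; exact: gauge_diam_ge0.
  rewrite eseries_cond/= eseries0 ?adde0; last first.
    by case=> //= k _ _; rewrite gauge_diam0.
  rewrite /gauge_diam; case: ifP => [_|A0]; first by rewrite lee_fin powR_ge0.
  rewrite -poweR_EFin gt0_ler_poweR// in_itv/= ?leey ?andbT ?lee_fin ?(ltW D0)//.
  by apply: diam_ge0; exact: ifs_nonempty S.
rewrite {1}(ifs_cover S).
apply: le_trans (outer_measure_bigcup_fin
  (@hausdorff_content R n t (rho ^+ m.+1 * D)) _) _.
have -> : moran L t ^+ m.+1 * D `^ t =
    \sum_i L i `^ t * (moran L t ^+ m * D `^ t).
  by rewrite exprS -mulrA -mulr_suml.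
rewrite -sumEFin; apply: lee_sum => i _.
apply: (@le_trans _ _ (hausdorff_content t (L i * (rho ^+ m * D)) (f i @` A))).
  apply: hausdorff_content_le_delta; rewrite exprS -mulrA ler_wpM2r//.
  by rewrite mulr_ge0 ?exprn_ge0 ?ltW.
apply: le_trans (hausdorff_content_scale _ _ t0 (L0 i) (ifs_scale S i)) _.
by rewrite EFinM lee_wpmul2l// lee_fin powR_ge0.
Qed.

Lemma hausdorff_content_moran_le1 (D t delta : R) :
  0 < D -> 0 <= t -> 0 < delta ->
  (forall x y, A x -> A y -> edist x y <= D) -> moran L t <= 1 ->
  (hausdorff_content t delta A <= (D `^ t)%:E)%E.
Proof.
move=> D0 t0 delta0 AD m1.
have [rho rho01 Lrho] := max_ratio (ifs_ge2 S) (ifs_ratio S).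
have /andP[rho0 _] := rho01.
have [m /ltW rhom] := exists_ratio_pow_lt rho01 D0 delta0.
apply: le_trans (hausdorff_content_le_delta _ _ rhom) _.
apply: le_trans (hausdorff_content_moran_pow m Lrho rho0 D0 t0 AD) _.
by rewrite lee_fin ler_piMl ?powR_ge0// exprn_ile1// moran_ge0.
Qed.

Lemma hausdorff_measure_lty (t : R) : 0 <= t -> moran L t <= 1 ->
  (hausdorff_measure t A < +oo)%E.
Proof.
move=> t0 m1; have [D D0 AD] := compact_edist_bounded (ifs_compact S).
apply: (@le_lt_trans _ _ ((hausdorff_const t)%:E * (D `^ t)%:E)%E); last first.
  by rewrite -EFinM ltry.
apply: lee_wpmul2l; first by rewrite lee_fin hausdorff_const_ge0.
apply: ge_ereal_sup => _ [delta /= delta0 <-].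
exact: hausdorff_content_moran_le1.
Qed.

Lemma hausdorff_measure_eq0 (t : R) : 0 <= t -> moran L t < 1 ->
  hausdorff_measure t A = 0%E.
Proof.
move=> t0 m1; have [D D0 AD] := compact_edist_bounded (ifs_compact S).
have [rho rho01 Lrho] := max_ratio (ifs_ge2 S) (ifs_ratio S).
have /andP[rho0 rho1] := rho01.
suff h0 delta : 0 < delta -> hausdorff_content t delta A = 0%E.
  rewrite /hausdorff_measure (_ : [set _ | _ in _] = [set 0%E]).
    by rewrite ereal_sup1 mule0.
  apply/seteqP; split=> [_ [s s0 <-]|_ ->]; first exact: h0.
  by exists 1; [exact: ltr01|exact: h0].
move=> delta0; apply/eqP; rewrite eq_le hausdorff_content_ge0 andbT.
apply/lee_addgt0Pr => eps eps0; rewrite add0e.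
(* A common base for both powers gives one exponent [k] that brings the scale [rho ^+ k * D] below
   [delta] and the content bound below [eps]. *)
have tau0 : 0 < Num.max (moran L t) rho by rewrite lt_max rho0 orbT.
have tau1 : Num.max (moran L t) rho < 1 by rewrite gt_max m1.
have [k Hk] : exists k, Num.max (moran L t) rho ^+ k * Num.max D (D `^ t)
    < Num.min delta eps.
  apply: exists_ratio_pow_lt; rewrite ?tau0 ?lt_max ?D0//.
  by rewrite lt_min delta0.
have bound a b : 0 <= a <= Num.max (moran L t) rho -> 0 <= b <= Num.max D (D `^ t) ->
    a ^+ k * b <= Num.min delta eps.
  move=> /andP[a0 am] /andP[b0 bm]; apply: le_trans (ltW Hk).
  by rewrite ler_pM ?exprn_ge0// lerXn2r// nnegrE ltW.
have kdelta : rho ^+ k * D <= delta.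
  have : rho ^+ k * D <= Num.min delta eps.
    by apply: bound; rewrite le_max lexx ?orbT ltW.
  by rewrite le_min => /andP[].
apply: le_trans (hausdorff_content_le_delta _ _ kdelta) _.
apply: le_trans (hausdorff_content_moran_pow k Lrho rho0 D0 t0 AD) _.
have : moran L t ^+ k * D `^ t <= Num.min delta eps.
  by apply: bound; rewrite le_max lexx ?orbT ?moran_ge0 ?powR_ge0.
by rewrite lee_fin le_min => /andP[].
Qed.

(* A set of diameter less than [e] meets at most one piece; pulling the sets
   that meet a piece back to [A] gives a cover of [A] by fewer sets. *)
Lemma gauge_diam_finite_cover (t : R) (s : seq (set 'cV[R]_n)) : 0 <= t ->
  1 <= moran L t -> A `<=` \bigcup_(G in [set` s]) G ->
  ((e `^ t)%:E <= \sum_(G <- s) gauge_diam t G)%E.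
Proof.
move=> t0 m1; move: {2}(size s) (leqnn (size s)) => k.
elim: k s => [|k IH] s sk As.
  move: sk; rewrite leqn0 size_eq0 => /eqP s0; move: As; rewrite s0.
  by have [x Ax] := ifs_nonempty S; move=> /(_ x Ax)[].
(* A single set of diameter at least [e] already has gauge at least [e^t]. *)
have [[G Gs eG]|small] := pselect (exists2 G, G \in s & (e%:E <= diam G)%E).
  rewrite (perm_big _ (perm_to_rem Gs))/= big_cons.
  apply: (@le_trans _ _ (gauge_diam t G)); last first.
    by rewrite leeDl// sume_ge0// => X _; exact: gauge_diam_ge0.
  rewrite /gauge_diam ifF; last first.
    by apply/eqP => G0; move: eG; rewrite G0 diam0 leeNy_eq.
  rewrite -poweR_EFin gt0_ler_poweR// in_itv/= ?leey ?andbT ?lee_fin ?(ltW e0)//.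
  by apply: le_trans eG; rewrite lee_fin ltW.
have Gsmall G i j x y : G \in s -> A x -> A y -> G (f i x) -> G (f j y) -> i = j.
  move=> Gs Ax Ay Gx Gy; apply/eqP/negPn/negP => ij; apply: small; exists G => //.
  by apply: le_trans (edist_le_diam Gx Gy); rewrite lee_fin (ifs_gap S).
pose meets i G := `[< exists2 x, A x & G (f i x) >].
pose si i := [seq f i @^-1` G | G <- s & meets i G].
(* Some set of [s] contains a point of another piece [j], so it misses piece [i], and [si i] is
   strictly shorter than [s]. *)
have sik i : (size (si i) <= k)%N.
  rewrite size_map size_filter -ltnS; apply: leq_trans sk.
  have [j ij] : exists j, i != j.
    pose i0 : 'I_N := Ordinal (ltnW (ifs_ge2 S)).
    pose i1 : 'I_N := Ordinal (ifs_ge2 S).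
    have [->|] := eqVneq i i0; first by exists i1.
    by exists i0.
  have [x Ax] := ifs_nonempty S; have [G /= Gs Gx] := As _ (fA j Ax).
  rewrite -(count_predC (meets i) s) -[X in (X < _)%N]addn0 ltn_add2l -has_count.
  apply/hasP; exists G => //=; apply/negP => /asboolP[y Ay Gy].
  by move: ij; rewrite (Gsmall G i j y x Gs Ay Ax Gy Gx) eqxx.
have siA i : A `<=` \bigcup_(G in [set` si i]) G.
  move=> x Ax; have [G /= Gs Gx] := As _ (fA i Ax).
  exists (f i @^-1` G) => //=; apply/mapP; exists G => //.
  by rewrite mem_filter Gs andbT; apply/asboolP; exists x.
have pull i G : ((L i `^ t)%:E * gauge_diam t (f i @^-1` G) <= gauge_diam t G)%E.
  have Lt0 : 0 < L i `^ t by exact: powR_gt0.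
  rewrite -lee_pdivlMl//.
  have <- : (L i)^-1 `^ t = (L i `^ t)^-1.
    by rewrite -powR_inv1 ?ltW// powRAC powR_inv1 ?ltW.
  apply: le_gauge_diam => //; first by rewrite invr_ge0 ltW.
    by move=> [x Gx]; exists (f i x).
  apply: diam_le => x y Gx Gy; rewrite lee_pdivlMl//.
  by rewrite -EFinM -(ifs_scale S); exact: edist_le_diam.
(* By induction each pulled-back cover has total gauge at least [e^t]; with weights [L i^t] these
   bounds add up to [moran L t * e^t], at least [e^t]. *)
apply: (@le_trans _ _ (\sum_i \sum_(G <- s | meets i G) gauge_diam t G)%E).
  apply: (@le_trans _ _ (\sum_i (L i `^ t)%:E * (e `^ t)%:E)%E).
    rewrite -ge0_sume_distrl; last by move=> i _; rewrite lee_fin powR_ge0.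
    by rewrite sumEFin -EFinM lee_fin ler_peMl// powR_ge0.
  apply: lee_sum => i _.
  apply: (@le_trans _ _ ((L i `^ t)%:E * \sum_(G <- si i) gauge_diam t G)%E).
    by apply: lee_wpmul2l; [rewrite lee_fin powR_ge0|exact: IH].
  rewrite big_map big_filter ge0_sume_distrr; last first.
    by move=> G _; exact: gauge_diam_ge0.
  by apply: lee_sum => G _; exact: pull.
rewrite [leLHS](eq_bigr (fun i =>
  \sum_(G <- s) if meets i G then gauge_diam t G else 0))%E; last first.
  by move=> i _; rewrite big_mkcond.
(* After the exchange of sums each [G] counts at most once, as it meets at most one piece. *)
rewrite exchange_big/= big_seq [leRHS]big_seq; apply: lee_sum => G Gs.
have [[i /asboolP[x Ax Gx]]|none] := pselect (exists i, meets i G).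
  rewrite (bigD1 i)//= big1 ?adde0; first by case: ifP => //; rewrite gauge_diam_ge0.
  move=> j ji; case: ifP => // /asboolP[y Ay Gy].
  by move: ji; rewrite (Gsmall G j i y x Gs Ay Ax Gy Gx) eqxx.
rewrite big1 ?gauge_diam_ge0// => i _; case: ifP => // mi.
by case: none; exists i.
Qed.

Lemma hausdorff_measure_gt0 (t : R) : 0 <= t -> 1 <= moran L t ->
  (0 < hausdorff_measure t A)%E.
Proof.
move=> t0 m1; rewrite mule_gt0 ?lte_fin ?hausdorff_const_gt0//.
apply: (@lt_le_trans _ _ (e `^ t)%:E); first by rewrite lte_fin powR_gt0.
apply: le_trans (hausdorff_content_le_sup _ _ (@ltr01 R)).
apply: hausdorff_content_ge_finite_cover => //; first exact: ifs_compact S.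
by move=> s As; exact: gauge_diam_finite_cover.
Qed.

(** The measure of [A] vanishes for exponents above the root of Moran's equation and is positive
    below it, so the dimension is that root. *)
Lemma hausdorff_dim_moran (d : R) : hausdorff_dim A = d%:E ->
  0 < d /\ moran L d = 1.
Proof.
have [s s0 ms] := moran_root (ifs_ge2 S) (ifs_ratio S).
suff -> : hausdorff_dim A = s%:E by move=> [<-].
apply/eqP; rewrite eq_le; apply/andP; split.
  apply/lee_addgt0Pr => eps eps0; rewrite -EFinD; apply: ereal_inf_lbound.
  exists (s + eps) => //; split; first by rewrite addr_ge0// ltW.
  apply: hausdorff_measure_eq0; first by rewrite addr_ge0// ltW.
  rewrite -ms; apply: (moran_decreasing (ifs_ge2 S) (ifs_ratio S)).
  by rewrite ltrDl.
apply: le_ereal_inf_tmp => _ [t [t0 tA] <-]; rewrite lee_fin leNgt.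
apply/negP => ts; have : (0 < hausdorff_measure t A)%E.
  apply: hausdorff_measure_gt0 => //; rewrite -ms ltW//.
  exact: (moran_decreasing (ifs_ge2 S) (ifs_ratio S)).
by rewrite tA ltxx.
Qed.

(** For [r >= e] the factor is at least 1. A smaller ball meets a single piece [i]; pulling back
    turns [r] into [r / L i], which the scaling factor [L i^d] of the measure compensates. *)
Lemma hausdorff_measure_oball_le (d : R) x r : 0 <= d -> A x -> 0 < r ->
  (hausdorff_restr d A (oball x r) <= ((r / e) `^ d)%:E * hausdorff_measure d A)%E.
Proof.
move=> d0 Ax r0.
have [rho rho01 Lrho] := max_ratio (ifs_ge2 S) (ifs_ratio S).
have large y t : e <= t ->
    (hausdorff_restr d A (oball y t) <=
     ((t / e) `^ d)%:E * hausdorff_measure d A)%E.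
  move=> et; apply: (@le_trans _ _ (hausdorff_measure d A)).
    by apply: le_hausdorff_measure => z [].
  rewrite -[leLHS]mul1e lee_wpmul2r ?hausdorff_measure_ge0// lee_fin.
  have <- : 1 `^ d = 1 :> R by rewrite powR1.
  have te : 1 <= t / e by rewrite ler_pdivlMr// mul1r.
  by rewrite ge0_ler_powR ?nnegrE// (le_trans ler01).
(* Each pull-back divides the radius by some [L i <= rho], so at most [m] of them are needed to
   reach [e]. *)
have [m /ltW] := exists_ratio_pow_lt rho01 e0 r0.
elim: m x r r0 Ax => [|m IH] x r r0 Ax rm.
  by apply: large; rewrite expr0 mul1r in rm.
have [er|re] := leP e r; first exact: large.
have [i _ [x' Ax' fx']] : (\bigcup_i f i @` A) x by rewrite -(ifs_cover S).
have sub : oball x r `&` A `<=` f i @` (oball x' (r / L i) `&` A).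
  move=> y [xy Ay].
  have [j _ [y' Ay' fy']] : (\bigcup_i f i @` A) y by rewrite -(ifs_cover S).
  have [ij|ij] := eqVneq i j; last first.
    have := ifs_gap S ij Ax' Ay'; rewrite fx' fy' => exy.
    by have := lt_trans (le_lt_trans exy xy) re; rewrite ltxx.
  subst j; exists y' => //; split => //; rewrite /oball/= ltr_pdivlMr//.
  by rewrite mulrC -(ifs_scale S) fx' fy'.
apply: le_trans (le_hausdorff_measure d sub) _.
apply: le_trans (hausdorff_measure_scale _ d0 (L0 i) (ifs_scale S i)) _.
apply: (@le_trans _ _ ((L i `^ d)%:E *
    (((r / L i / e) `^ d)%:E * hausdorff_measure d A))%E).
  apply: lee_wpmul2l; first by rewrite lee_fin powR_ge0.
  apply: IH => //; first by rewrite divr_gt0.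
  rewrite ler_pdivlMr// (le_trans _ rm)// exprS mulrC mulrA ler_wpM2r ?(ltW e0)//.
  by rewrite ler_wpM2r// exprn_ge0//; have /andP[/ltW] := rho01.
rewrite muleA -EFinM -powRM ?(ltW (L0 i))//; last first.
  by rewrite !divr_ge0// ltW.
rewrite (_ : L i * (r / L i / e) = r / e)//.
by field; rewrite !gt_eqF.
Qed.

(** * Borel sets are measurable for the restricted Hausdorff measure *)

Context (d : R).
Let nu := @hausdorff_restr R n d A.

Let nu0 : nu set0 = 0%E.
Proof. by rewrite /nu /hausdorff_restr set0I hausdorff_measure0. Qed.

Let nu_ge0 E : (0 <= nu E)%E. Proof. exact: hausdorff_measure_ge0. Qed.

Let le_nu : {homo nu : E F / E `<=` F >-> (E <= F)%E}.
Proof. by move=> E F EF; apply: le_hausdorff_measure; exact: setSI. Qed.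

Let nu_sigma_subadditive : sigma_subadditive nu.
Proof.
move=> F; rewrite /nu /hausdorff_restr setI_bigcupl.
exact: hausdorff_measure_sigma_subadditive.
Qed.

HB.instance Definition _ :=
  isOuterMeasure.Build R 'cV[R]_n nu nu0 nu_ge0 le_nu nu_sigma_subadditive.

(** [nu] only sees [A], where [B] and its complement are [eta] apart, so metric additivity splits
    every test set [X]. *)
Let caratheodory_separated (B : set 'cV[R]_n) (eta : R) : 0 < eta ->
  B `<=` A -> (forall x y, B x -> A y -> ~ B y -> eta <= edist x y) ->
  nu.-caratheodory B.
Proof.
move=> eta0 BA Beta; apply: le_caratheodory_measurable => X.
rewrite /nu /hausdorff_restr.
apply: (@le_trans _ _
  (hausdorff_measure d ((X `&` B `&` A) `|` (X `&` ~` B `&` A)))).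
  apply: (hausdorff_measure_separated _ eta0) => x y [[_ Bx] _] [[_ By] Ay].
  exact: Beta.
by apply: le_hausdorff_measure => x [[[Xx _] Ax]|[[Xx _] Ax]].
Qed.

(* These unions of pieces exhaust [V `&` A] and lie at positive distance from the
   rest of [A], so the metric additivity of Hausdorff measure applies to them. *)
Fixpoint pieces_inside (m : nat) (V : set 'cV[R]_n) : set 'cV[R]_n :=
  if m is m'.+1 then \bigcup_i f i @` pieces_inside m' (f i @^-1` V)
  else [set x | A x /\ A `<=` V].

Let pieces_inside_sub m (V : set 'cV[R]_n) : pieces_inside m V `<=` V `&` A.
Proof.
elim: m V => [V x [Ax AO]|m IH V x [i _ [y /IH[Oy Ay] <-]]].
  by split=> //; exact: AO.
by split=> //; exact: fA.
Qed.

(** Points of different pieces are at least [e] apart; inside piece [i] the gap found for the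
    preimage shrinks by the factor [L i]. *)
Let pieces_inside_separated m (V : set 'cV[R]_n) : exists2 eta : R, 0 < eta &
  forall x y, pieces_inside m V x -> A y -> ~ pieces_inside m V y ->
    eta <= edist x y.
Proof.
elim: m V => [V|m IH V]; first by exists 1 => // x y [Ax AO] Ay []; split.
have /choice[eta eta_gap] : forall i, exists eta : R, 0 < eta /\
    forall x y, pieces_inside m (f i @^-1` V) x -> A y ->
      ~ pieces_inside m (f i @^-1` V) y -> eta <= edist x y.
  by move=> i; have [t t0 Ht] := IH (f i @^-1` V); exists t.
exists (Num.min e (\big[Num.min/1]_i (L i * eta i))).
  rewrite lt_min e0/=; elim/big_ind : _ => // [x y x0 y0|i _].
    by rewrite lt_min x0.
  by rewrite mulr_gt0//; have [] := eta_gap i.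
move=> _ y [i _ [x px <-]]; have [_ Ax] := pieces_inside_sub px.
move=> Ay npy.
have [j _ [y' Ay' fy']] : (\bigcup_i f i @` A) y by rewrite -(ifs_cover S).
rewrite -fy' ge_min; have [ij|ij] := eqVneq i j; apply/orP; last first.
  by left; exact: ifs_gap S _ _ _ _ ij Ax Ay'.
right; subst j; apply: (@le_trans _ _ (L i * eta i)); first exact: bigmin_le.
rewrite (ifs_scale S) ler_wpM2l ?(ltW (L0 i))//.
have [_] := eta_gap i; apply => // py'; apply: npy.
by exists i => //; exists y'.
Qed.

(** Each pull-back enlarges the free radius around the point from [r] to [r / L i]; after [m] of
    them it exceeds the bound [D] on distances in [A], so all of [A] fits. *)
Let pieces_inside_exhaust (rho D : R) m (V : set 'cV[R]_n) x r :
  (forall i, L i <= rho) -> 0 <= D -> 0 < rho ->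
  (forall x y, A x -> A y -> edist x y <= D) ->
  A x -> oball x r `<=` V -> rho ^+ m * D < r -> pieces_inside m V x.
Proof.
move=> Lrho D0 rho0 AD; elim: m V x r => [|m IH] V x r Ax xO.
  rewrite expr0 mul1r => Dr; split=> // y Ay; apply: xO.
  by rewrite /oball/= (le_lt_trans (AD _ _ Ax Ay)).
move=> rr; have [i _ [y Ay fy]] : (\bigcup_i f i @` A) x by rewrite -(ifs_cover S).
exists i => //; exists y => //; apply: (IH _ _ (r / L i)) => //.
- move=> z yz; apply: xO; rewrite /oball/= -fy (ifs_scale S) mulrC -ltr_pdivlMr//.
- rewrite ltr_pdivlMr// (le_lt_trans _ rr)// exprS mulrC mulrA ler_wpM2r//.
  by rewrite ler_wpM2r// exprn_ge0// ltW.
Qed.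

Let caratheodory_open (V : set 'cV[R]_n) : open V -> nu.-caratheodory V.
Proof.
move=> Oo; have [D D0 AD] := compact_edist_bounded (ifs_compact S).
have [rho rho01 Lrho] := max_ratio (ifs_ge2 S) (ifs_ratio S).
have OAE : V `&` A = \bigcup_m pieces_inside m V.
  apply/seteqP; split=> [x [Ox Ax]|x [m _]]; last exact: pieces_inside_sub.
  have [r r0 rO] := open_oballP Oo Ox.
  have [m rm] := exists_ratio_pow_lt rho01 D0 r0.
  exists m => //; apply: (pieces_inside_exhaust Lrho (ltW D0) _ AD Ax rO rm).
  by have /andP[] := rho01.
have : nu.-caratheodory (V `&` A).
  rewrite OAE; apply: caratheodory_measurable_bigcup => m.
  have [eta eta0 Heta] := pieces_inside_separated m V.
  by apply: (caratheodory_separated eta0 _ Heta) => x /pieces_inside_sub[].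
(* [V] and its intersection with [A] have the same trace on [A], and so do their complements. *)
move=> OA X; rewrite (OA X) /nu /hausdorff_restr; congr (_ + _)%E.
  by congr hausdorff_measure; rewrite -!setIA setIid.
congr hausdorff_measure; rewrite setCI setIUr setIUl.
by rewrite -(setIA _ (~` A)) setICl setI0 setU0.
Qed.

Let caratheodory_borel (B : set (borel_Rn R n)) : measurable B ->
  nu.-caratheodory B.
Proof.
suff : measurable `<=` (nu.-caratheodory : set (set (borel_Rn R n))) by apply.
apply: smallest_sub; last by move=> V; exact: caratheodory_open.
split.
- exact: caratheodory_measurable_set0.
- by move=> E mE; rewrite setTD; exact: caratheodory_measurable_setC.
- by move=> F mF; exact: caratheodory_measurable_bigcup.
Qed.

Let nu_sigma_additive : semi_sigma_additive (nu : set (borel_Rn R n) -> \bar R).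
Proof.
move=> F mF tF mUF.
apply: (@caratheodory_measure_sigma_additive _ _ nu) => // [i|].
  exact: caratheodory_borel.
exact: caratheodory_borel.
Qed.

Lemma hausdorff_probability : (0 < hausdorff_measure d A < +oo)%E ->
  exists P : probability (borel_Rn R n) R, forall E,
    P E = ((fine (hausdorff_measure d A))^-1%:E * hausdorff_restr d A E)%E.
Proof.
move=> /andP[HA0 HAoo].
pose m : {measure set (borel_Rn R n) -> \bar R} :=
  HB.pack (nu : set (borel_Rn R n) -> \bar R)
    (isMeasure.Build _ _ _ (nu : set (borel_Rn R n) -> \bar R)
      nu0 nu_ge0 nu_sigma_additive).
(* The Dirac mass is the default of [mnormalize] for zero or infinite total mass, both excluded by
   hypothesis. *)
exists (mnormalize m (dirac point)) => E.
have mT : m setT = hausdorff_measure d A by rewrite /m/= /nu /hausdorff_restr setTI.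
by rewrite /= /mnormalize mT (gt_eqF HA0) (lt_eqF HAoo)/= muleC.
Qed.

End self_similar_measure.

(** * Riesz energies *)

Section power_integrals.
Context (R : realType).
Local Notation leb := (@lebesgue_measure R).
Implicit Types (a q k : R).

Let powR_cont q (x : R) : 0 < x -> {for x, continuous (fun r : R => r `^ q)}.
Proof.
move=> x0; apply/differentiable_continuous/derivable1_diffP.
by apply: derivable_powR; rewrite in_itv/= x0.
Qed.

Lemma measurable_powR_EFin (D : set R) q :
  measurable_fun D (fun r : R => (r `^ q)%:E).
Proof.
apply/measurable_EFinP/measurable_funTS; exact: measurable_powR.
Qed.

(** The antiderivative is [k * r^q]; the factor [k] accommodates both [q > 0] with [k = 1] and
    [q = - p] with [k = -1]. *)
Lemma integral_powR_itv a q k : 0 < a -> a < 1 ->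
  (\int[leb]_(r in `]a, 1%R[) (k * q * r `^ (q - 1))%:E = (k * (1 - a `^ q))%:E)%E.
Proof.
move=> a0 a1.
have mf (D : set R) : measurable_fun D (fun r : R => (k * q * r `^ (q - 1))%:E).
  apply/measurable_EFinP/measurable_funTS.
  by apply: measurable_funM => //; exact: measurable_powR.
have Fc x : 0 < x -> {for x, continuous (fun r : R => k * r `^ q)}.
  by move=> x0; apply: cvgM; [exact: cvg_cst|exact: powR_cont].
rewrite integral_itv_bndo_bndc// integral_itv_obnd_cbnd//.
rewrite (@continuous_FTC2 _ _ (fun r => k * r `^ q))//.
- by rewrite powR1 mulrBr EFinB.
- apply: continuous_in_subspaceT => x; rewrite inE/= in_itv/= => /andP[ax _].
  apply: cvgM; first exact: cvg_cst.
  by apply: powR_cont; exact: lt_le_trans ax.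
- split.
  + move=> x; rewrite in_itv/= => /andP[ax _].
    apply: derivableM; first exact: derivable_cst.
    by apply: derivable_powR; rewrite in_itv/= andbT (lt_trans a0).
  + by apply: cvg_at_right_filter; exact: Fc.
  + by apply: cvg_at_left_filter; exact: Fc.
- move=> x; rewrite in_itv/= => /andP[ax _].
  have x0 : x \in `]0, +oo[ by rewrite in_itv/= andbT (lt_trans a0).
  rewrite derive1E deriveMl; last exact: derivable_powR.
  by rewrite -derive1E powR_derive1//= mulrA.
Qed.

Lemma integral_powR_le q : 0 < q ->
  (\int[leb]_(r in `]0%R, 1%R[) (q * r `^ (q - 1))%:E <= 1%:E)%E.
Proof.
(* The integrand may be singular at 0, hence a monotone limit over intervals away from 0; the shift
   by 2 keeps their left end below 1. *)
move=> q0; pose F (m : nat) : set R := `](m.+2%:R)^-1, 1[%classic.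
have mf (D : set R) : measurable_fun D (fun r : R => (q * r `^ (q - 1))%:E).
  apply/measurable_EFinP/measurable_funTS.
  by apply: measurable_funM => //; exact: measurable_powR.
have FU : \bigcup_m F m = [set` `]0%R, 1%R[].
  apply/seteqP; split => x /=.
    move=> [m _]; rewrite /F/= !in_itv/= => /andP[mx ->]; rewrite andbT.
    by apply: lt_trans mx; rewrite invr_gt0.
  rewrite in_itv/= => /andP[x0 x1].
  have [m mx] : exists m : nat, x^-1 < m%:R.
    by exists (Num.truncn x^-1).+1; exact: truncnS_gt.
  exists m => //; rewrite /F/= in_itv/= x1 andbT.
  rewrite invf_plt ?posrE// (lt_le_trans mx)// ler_nat.
  by rewrite (leq_trans (leqnSn _)).
have cvF : (\int[leb]_(r in F m) (q * r `^ (q - 1))%:E)%E @[m --> \oo] -->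
    (\int[leb]_(r in `]0%R, 1%R[) (q * r `^ (q - 1))%:E)%E.
  rewrite -FU; apply: ge0_nondecreasing_set_cvg_integral.
  - move=> i j ij; apply/subsetPset => x; rewrite /F/= !in_itv/= => /andP[ix ->].
    rewrite andbT (le_lt_trans _ ix)// lef_pV2 ?posrE// ler_nat.
    by rewrite !ltnS.
  - by move=> m; exact: measurable_itv.
  - by move=> m; exact: mf.
  - by move=> m x _; rewrite lee_fin mulr_ge0 ?powR_ge0// ltW.
apply: (cvge_to_le cvF).
apply: nearW => m.
have := @integral_powR_itv (m.+2%:R)^-1 q 1; rewrite invr_gt0 ltr0n => /(_ isT).
rewrite invf_lt1 ?ltr1n// mul1r => /(_ isT) ->.
by rewrite lee_fin mul1r lerBlDr lerDl powR_ge0.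
Qed.

End power_integrals.

(** * Layer-cake formula for the Riesz kernel *)

Section riesz_tail.
Context (R : realType) (n : nat).
Local Notation leb := (@lebesgue_measure R).
Local Notation T := (borel_Rn R n).
Local Open Scope ereal_scope.

Lemma measurable_open_borel (V : set T) : open (V : set 'cV[R]_n) -> measurable V.
Proof. by move=> Vo; exact: sub_sigma_algebra. Qed.

Lemma measurable_closed_borel (V : set T) :
  closed (V : set 'cV[R]_n) -> measurable V.
Proof.
move=> Vc; rewrite -(setCK V); apply: measurableC; apply: measurable_open_borel.
exact: closed_openC.
Qed.

Lemma continuous_borel_measurable (g : 'cV[R]_n -> R) : continuous g ->
  measurable_fun [set: T] (g : T -> R).
Proof.
move=> gc mT; apply: (measurability _ (RGenOInfty.measurableE R)) => //.
move=> /= _ [_ [a ->] <-]; rewrite setTI.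
apply: measurable_open_borel; apply: open_comp => //.
Qed.

Lemma measurable_edist : measurable_fun [set: T * T]
  (fun q : T * T => edist (q.1 : 'cV[R]_n) (q.2 : 'cV[R]_n)).
Proof.
apply: (@measurableT_comp _ _ _ _ _ _ (@Num.sqrt R)).
  by apply: continuous_measurable_fun; exact: sqrt_continuous.
apply: measurable_sum => i; apply: measurable_funX.
have mi : measurable_fun [set: T] (fun x : 'cV[R]_n => x i 0%R).
  by apply: continuous_borel_measurable; exact: coord_continuous.
by apply: measurable_funB; apply: (measurableT_comp mi).
Qed.

(* Up to the factor [p], the part over [r < 1] of the layer-cake formula
   [|x - y|^-p = p * \int_(|x - y|)^oo r^(-p-1) dr]. *)
Definition riesz_tail (p : R) (x y : 'cV[R]_n) : \bar R :=
  \int[leb]_r (if (edist x y < r)%R && (r < 1)%R then (r `^ (- p - 1))%:E else 0).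

Let integrand p (z : (T * T) * R) : \bar R :=
  if (edist (z.1.1 : 'cV[R]_n) (z.1.2 : 'cV[R]_n) < z.2)%R && (z.2 < 1)%R
  then (z.2 `^ (- p - 1))%:E else 0.

Let integrand_ge0 p z : 0 <= integrand p z.
Proof. by rewrite /integrand; case: ifP => // _; rewrite lee_fin powR_ge0. Qed.

Let measurable_integrand p : measurable_fun [set: (T * T) * R] (integrand p).
Proof.
apply: measurable_fun_ifT => //.
- apply: measurable_and; apply: measurable_fun_ltr => //.
  by apply: (measurableT_comp measurable_edist).
- apply: (measurableT_comp (f := fun r : R => (r `^ (- p - 1))%:E)) => //.
  exact: measurable_powR_EFin.
Qed.

Lemma riesz_tail_ge0 p x y : 0 <= riesz_tail p x y.
Proof.
by apply: integral_ge0 => r _; case: ifP => // _; rewrite lee_fin powR_ge0.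
Qed.

Lemma measurable_riesz_tail p : measurable_fun [set: T * T]
  (fun q : T * T => riesz_tail p q.1 q.2).
Proof.
exact: (measurable_fun_fubini_tonelli_F (m2 := leb) (integrand p)
  (@measurable_integrand p) (@integrand_ge0 p)).
Qed.

Lemma measurable_riesz_kernel p : measurable_fun [set: T * T]
  (fun q : T * T => riesz_kernel p (q.1 : 'cV[R]_n) (q.2 : 'cV[R]_n)).
Proof.
rewrite (_ : (fun q => _) = fun q : T * T =>
  if edist (q.1 : 'cV[R]_n) (q.2 : 'cV[R]_n) == 0%R then +oo
  else (edist (q.1 : 'cV[R]_n) (q.2 : 'cV[R]_n) `^ (- p))%:E); last first.
  apply/funext => -[x y]/=; rewrite /riesz_kernel.
  have [<-|/edist_gt0 xy] := eqVneq x y; first by rewrite edistxx eqxx.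
  by rewrite gt_eqF.
apply: measurable_fun_ifT => //.
- by apply: measurable_fun_eqr => //; exact: measurable_edist.
- apply: (measurableT_comp (f := fun r : R => (r `^ (- p))%:E)).
    exact: measurable_powR_EFin.
  exact: measurable_edist.
Qed.

(** Only radii in []a, 1[] are kept. Any [a] above the distance is allowed, so that on the diagonal
    [a] can be taken arbitrarily small. *)
Lemma riesz_tail_ge p x y (a : R) : (0 < p)%R -> (edist x y <= a)%R ->
  (0 < a < 1)%R -> (a `^ (- p) - 1)%:E <= p%:E * riesz_tail p x y.
Proof.
move=> p0 xya /andP[a0 a1].
have mJ : measurable_fun [set: R] (fun r : R =>
    if (edist x y < r)%R && (r < 1)%R then (r `^ (- p - 1))%:E else 0).
  apply: measurable_fun_ifT => //; last exact: measurable_powR_EFin.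
  by apply: measurable_and; apply: measurable_fun_ltr.
rewrite -ge0_integralZl//; last 2 first.
- by move=> r _; case: ifP => // _; rewrite lee_fin powR_ge0.
- by rewrite lee_fin ltW.
apply: (@le_trans _ _ (\int[leb]_(r in `]a, 1%R[) (p * r `^ (- p - 1))%:E)).
  have := @integral_powR_itv R a (- p) (-1) a0 a1.
  rewrite (_ : (-1 * - p = p)%R); last by ring.
  by move=> ->; rewrite mulN1r opprB.
apply: (@le_trans _ _ (\int[leb]_(r in `]a, 1%R[) (p%:E *
  (if (edist x y < r)%R && (r < 1)%R then (r `^ (- p - 1))%:E else 0)))).
  rewrite le_eqVlt; apply/orP; left; apply/eqP; apply: eq_integral => r.
  rewrite inE/= in_itv/= => /andP[ar r1].
  by rewrite (le_lt_trans xya ar) r1 EFinM.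
apply: ge0_subset_integral => //.
- exact: measurable_funeM.
- move=> r _; rewrite mule_ge0 ?lee_fin ?(ltW p0)//.
  by case: ifP => // _; rewrite lee_fin powR_ge0.
Qed.

(** The summand 1 pays for cutting the radii at 1: it is the boundary term for points closer than 1
    and bounds the kernel for the others. *)
Lemma riesz_kernel_le_tail p x y : (0 < p)%R ->
  riesz_kernel p x y <= 1 + p%:E * riesz_tail p x y.
Proof.
move=> p0; have pt0 : 0 <= p%:E * riesz_tail p x y.
  by rewrite mule_ge0 ?riesz_tail_ge0// lee_fin ltW.
rewrite /riesz_kernel; have [xy|/edist_gt0 xy] := eqVneq x y.
  rewrite leye_eq; apply/eqP/eqyP => M M0.
  (* Solves [a^(-p) = 1 + M], so that the right-hand side exceeds any given [M] on the diagonal. *)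
  pose a : R := ((1 + M) `^ (- p^-1))%R.
  have M1 : (1 < 1 + M)%R by rewrite ltrDl.
  have a0 : (0 < a)%R by rewrite powR_gt0// (lt_trans ltr01).
  have aM : (a `^ (- p) = 1 + M)%R.
    rewrite -powRrM mulrNN mulVf ?gt_eqF// powRr1//.
    by rewrite ltW// (lt_trans ltr01).
  have a1 : (a < 1)%R.
    rewrite ltNge; apply/negP => a1; have : (a `^ (- p) <= 1)%R.
      by rewrite -[leRHS](powRr0 a) ler_powR// lerNl oppr0 ltW.
    by rewrite aM leNgt M1.
  have := @riesz_tail_ge p x y a p0.
  rewrite {1}xy edistxx (ltW a0) a0 a1 aM => /(_ isT isT) H.
  apply: le_trans (leeD (lexx 1) H).
  by rewrite -EFinD lee_fin; lra.
have [xy1|xy1] := ltP (edist x y) 1%R.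
  have := @riesz_tail_ge p x y (edist x y) p0 (lexx _).
  rewrite xy xy1 => /(_ isT) H; apply: le_trans (leeD (lexx 1) H).
  by rewrite -EFinD lee_fin; lra.
apply: (@le_trans _ _ 1); last by rewrite leeDl.
by rewrite lee_fin -[leRHS](powRr0 (edist x y)) ler_powR// lerNl oppr0 ltW.
Qed.

(** The integral in [has_second_order_density]: times [d - p], its left limit at [d] is the density
    of [P] at [x]. *)
Definition truncated_potential (P : set 'cV[R]_n -> \bar R) (p : R)
    (x : 'cV[R]_n) : \bar R :=
  \int[leb]_(r in `]0%R, 1%R[) (P (oball x r) * (r `^ (- p - 1))%:E).

(** By Tonelli the integral over [y] comes first, and for fixed [r] it produces the mass of the
    ball. Radii [r <= 0] contribute nothing because their balls are empty. *)
Lemma integral_riesz_tail (P : probability T R) p x :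
  \int[P]_y riesz_tail p x y = truncated_potential P p x.
Proof.
pose J (z : T * R) := integrand p ((x, z.1), z.2).
have mJ : measurable_fun [set: T * R] J.
  apply: (measurableT_comp (measurable_integrand p)).
  by apply: measurable_fun_pair => //; apply: measurable_fun_pair.
have := fubini_tonelli (m1 := P) (m2 := leb) J mJ (fun z => integrand_ge0 p _).
rewrite /J /integrand/= => ->.
rewrite /truncated_potential [RHS]integral_mkcond; apply: eq_integral => r _.
rewrite patchE; have mB : measurable (oball x r : set T).
  by apply: measurable_open_borel; exact: oball_open.
have [r1|r1] := ltP r 1%R; last first.
  rewrite memNset; last by rewrite /= in_itv/= (ltNge r) r1 andbF.
  by apply: integral0_eq => y _; rewrite andbF.
have -> : \int[P]_y (if (edist x y < r)%R && true then (r `^ (- p - 1))%:E else 0)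
    = (r `^ (- p - 1))%:E * P (oball x r).
  rewrite -(integral_cst P mB) [RHS]integral_mkcond; apply: eq_integral => y _.
  rewrite patchE andbT; case: ifPn => xy.
    by rewrite mem_set.
  by rewrite memNset//; exact/negP.
have [r0|r0] := ltP 0%R r.
  have r01 : [set` `]0%R, 1%R[] r by rewrite /= in_itv/= r0.
  by rewrite (mem_set r01) muleC.
have r01 : ~ [set` `]0%R, 1%R[] r by rewrite /= in_itv/= ltNge r0.
rewrite (memNset r01).
rewrite (_ : oball x r = set0) ?measure0 ?mule0//.
apply/seteqP; split=> // y; rewrite /oball/= ltNge => /negP; apply.
exact: le_trans r0 (edist_ge0 _ _).
Qed.

Lemma truncated_potential_ge0 (P : probability T R) p x :
  0 <= truncated_potential P p x.
Proof.
by apply: integral_ge0 => r _; rewrite mule_ge0// lee_fin powR_ge0.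
Qed.

Lemma measurable_truncated_potential (P : probability T R) p :
  measurable_fun [set: T] (truncated_potential P p).
Proof.
rewrite (_ : truncated_potential P p = fun x => \int[P]_y riesz_tail p x y).
  apply: (measurable_fun_fubini_tonelli_F (m2 := P)
    (fun q : T * T => riesz_tail p q.1 q.2)).
    exact: measurable_riesz_tail.
  by move=> q; exact: riesz_tail_ge0.
by apply/funext => x; rewrite integral_riesz_tail.
Qed.

Lemma measurable_oball_mass (P : probability T R) x :
  measurable_fun [set: R] (fun r : R => P (oball x r)).
Proof.
have mB r : measurable (oball x r : set T).
  by apply: measurable_open_borel; exact: oball_open.
rewrite (_ : (fun r => _) = fun r : R =>
    \int[P]_y (if (edist x (y : 'cV[R]_n) < r)%R then 1 else 0)); last first.
  apply/funext => r; rewrite -[LHS]mul1e -(integral_cst P (mB r)).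
  rewrite [LHS]integral_mkcond; apply: eq_integral => y _; rewrite patchE.
  case: ifPn => [/set_mem xy|]; first by rewrite ifT.
  by move/negP => xy; rewrite ifF//; apply/negP => xyr; apply: xy; rewrite inE.
apply: (measurable_fun_fubini_tonelli_F (m2 := P)
  (fun z : R * T => if (edist x (z.2 : 'cV[R]_n) < z.1)%R then 1 else 0)).
  apply: measurable_fun_ifT => //; apply: measurable_fun_ltr => //.
  have mx : measurable_fun [set: T] (edist x).
    by apply: continuous_borel_measurable; exact: edist_continuous.
  exact: (measurableT_comp mx).
by move=> z; case: ifP.
Qed.

Lemma measurable_truncated_integrand (P : probability T R) x p (D : set R) :
  measurable_fun D (fun r : R => P (oball x r) * (r `^ (- p - 1))%:E).
Proof.
apply: measurable_funTS; apply: emeasurable_funM.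
  exact: measurable_oball_mass.
exact: measurable_powR_EFin.
Qed.

End riesz_tail.

(** * Bounds on the Riesz energy and on the potential *)

Section riesz_energy_bounds.
Context (R : realType) (n : nat).
Local Notation leb := (@lebesgue_measure R).
Local Notation T := (borel_Rn R n).
Local Open Scope ereal_scope.

Let mkernel p (x : T) : measurable_fun [set: T] (riesz_kernel p (x : 'cV[R]_n)).
Proof.
have := @measurable_riesz_kernel R n p.
move=> /(@measurableT_comp _ _ _ _ _ _ _ _ (fun y : T => (x, y))); apply.
by apply: measurable_fun_pair.
Qed.

Let kernel_ge0 p (x y : 'cV[R]_n) : 0 <= riesz_kernel p x y.
Proof. by rewrite /riesz_kernel; case: ifP => // _; rewrite lee_fin powR_ge0. Qed.

Let measurable_kernel_integral (P : probability T R) (A : set T) p :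
  measurable A ->
  measurable_fun [set: T] (fun x : T => \int[P]_(y in A) riesz_kernel p x y).
Proof.
move=> mA; rewrite (_ : (fun x => _) = fun x : T =>
    \int[P]_y (if y \in A then riesz_kernel p x y else 0)); last first.
  by apply/funext => x; rewrite integral_mkcond; apply: eq_integral => y _.
apply: (measurable_fun_fubini_tonelli_F (m2 := P) (fun q : T * T =>
    if q.2 \in A then riesz_kernel p (q.1 : 'cV[R]_n) q.2 else 0)).
  apply: measurable_fun_ifT => //; last exact: measurable_riesz_kernel.
  apply: (measurableT_comp (f := fun y : T => y \in A)) => //.
  apply: (measurable_fun_bool true); rewrite setTI.
  rewrite (_ : _ @^-1` _ = A)//.
  by apply/seteqP; split=> y /=; [move/set_mem|exact: mem_set].
by move=> q; case: ifP.
Qed.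

Let integral_affine (P : probability T R) (A : set T) (g : T -> \bar R) (p : R) :
  measurable A -> P A = 1 -> (0 <= p)%R -> measurable_fun A g ->
  (forall x, 0 <= g x) ->
  \int[P]_(x in A) (1 + p%:E * g x) = 1 + p%:E * \int[P]_(x in A) g x.
Proof.
move=> mA PA p0 mg g0; rewrite ge0_integralD//.
- by rewrite (integral_cst P mA 1) mul1e [X in X + _]PA ge0_integralZl.
- by move=> x _; rewrite mule_ge0.
- exact: measurable_funeM.
Qed.

(** [P] competes in the infimum, and the pointwise bound on the kernel is integrated in both
    variables. *)
Lemma riesz_energy_le (P : probability T R) (A : set T) p :
  measurable A -> P A = 1 -> (0 < p)%R ->
  riesz_energy p A <= 1 + p%:E * \int[P]_(x in A) truncated_potential P p x.
Proof.
move=> mA PA p0; apply: (@le_trans _ _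
  (\int[P]_(x in A) \int[P]_(y in A) riesz_kernel p x y)).
  by apply: ereal_inf_lbound; exists P.
have mtp : measurable_fun A (truncated_potential P p).
  by apply: measurable_funTS; exact: measurable_truncated_potential.
have tp0 x : 0 <= truncated_potential P p x by exact: truncated_potential_ge0.
rewrite -(integral_affine mA PA (ltW p0) mtp tp0).
apply: ge0_le_integral => //.
- by move=> x _; apply: integral_ge0.
- by apply: measurable_funTS; exact: measurable_kernel_integral.
- by apply: emeasurable_funD => //; exact: measurable_funeM.
move=> x Ax; rewrite -integral_riesz_tail.
have mtail : measurable_fun [set: T] (riesz_tail p (x : 'cV[R]_n)).
  have := @measurable_riesz_tail R n p.
  move=> /(@measurableT_comp _ _ _ _ _ _ _ _ (fun y : T => (x, y))); apply.
  by apply: measurable_fun_pair.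
apply: (@le_trans _ _ (\int[P]_y (1 + p%:E * riesz_tail p x y))).
  apply: (@le_trans _ _ (\int[P]_y riesz_kernel p x y)).
    by apply: ge0_subset_integral.
  apply: ge0_le_integral => //.
  - by apply: emeasurable_funD => //; exact: measurable_funeM.
  - by move=> y _; exact: riesz_kernel_le_tail.
by rewrite (integral_affine measurableT (probability_setT P) (ltW p0) mtail)//
  => y; exact: riesz_tail_ge0.
Qed.

(** On [A] the kernel is at least [D^(-p)]. This keeps the energy positive, so that bounds on it can
    be inverted. *)
Lemma riesz_energy_ge (A : set T) (D p : R) : measurable A -> (0 < p)%R ->
  (0 < D)%R -> (forall x y : 'cV[R]_n, A x -> A y -> (edist x y <= D)%R) ->
  (D `^ (- p))%:E <= riesz_energy p A.
Proof.
move=> mA p0 D0 AD; apply: le_ereal_inf_tmp => _ [P PA <-].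
have key x : A x -> (D `^ (- p))%:E <= \int[P]_(y in A) riesz_kernel p x y.
  move=> Ax; rewrite -[leLHS]mule1 -PA -(integral_cst P mA).
  apply: ge0_le_integral => //.
  - by move=> y _; rewrite lee_fin powR_ge0.
  - by apply: measurable_funTS; exact: mkernel.
  move=> y Ay; rewrite /riesz_kernel/=; case: eqVneq => [_|/edist_gt0 xy].
    by rewrite leey.
  rewrite lee_fin !powRN lef_pV2 ?posrE ?powR_gt0//.
  by rewrite ge0_ler_powR ?nnegrE ?edist_ge0 ?(ltW p0) ?(ltW D0) ?AD.
rewrite -[leLHS]mule1 -PA -(integral_cst P mA).
apply: ge0_le_integral => //.
- by move=> y _; rewrite lee_fin powR_ge0.
- by apply: measurable_funTS; exact: measurable_kernel_integral.
Qed.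

(** The factor [d - p] cancels the growth of the integral of [r^(d-p-1)]; the bound is uniform in
    [p] and provides the dominating constant. *)
Lemma truncated_potential_le (P : probability T R) x (C d p : R) :
  (0 <= C)%R -> (p < d)%R ->
  (forall r, (0 < r < 1)%R -> P (oball x r) <= (C * r `^ d)%:E) ->
  (d - p)%:E * truncated_potential P p x <= C%:E.
Proof.
move=> C0 pd PC; have q0 : (0 < d - p)%R by rewrite subr_gt0.
have mq (E : set R) : measurable_fun E (fun r => ((d - p) * r `^ (d - p - 1))%:E).
  apply/measurable_EFinP/measurable_funTS.
  by apply: measurable_funM => //; exact: measurable_powR.
rewrite -ge0_integralZl//; last 3 first.
- exact: measurable_truncated_integrand.
- by move=> r _; rewrite mule_ge0// lee_fin powR_ge0.
- by rewrite lee_fin ltW.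
apply: (@le_trans _ _ (\int[leb]_(r in `]0%R, 1%R[)
    (C%:E * ((d - p) * r `^ (d - p - 1))%:E))).
  apply: ge0_le_integral => //.
  - move=> r _; rewrite !mule_ge0// lee_fin ?powR_ge0// ltW//.
  - by apply: measurable_funeM; exact: measurable_truncated_integrand.
  - by apply: measurable_funeM; exact: mq.
  move=> r /=; rewrite in_itv/= => r01; have /andP[r0 r1] := r01.
  have -> : (r `^ (d - p - 1) = r `^ d * r `^ (- p - 1))%R.
    by rewrite -powRD ?addrA// (gt_eqF r0) implybT.
  rewrite -EFinM mulrCA EFinM lee_wpmul2l ?lee_fin ?(ltW q0)//.
  rewrite mulrA EFinM lee_wpmul2r ?lee_fin ?powR_ge0//.
  exact: PC.
have q0' r : [set` `]0%R, 1%R[] r -> 0 <= ((d - p) * r `^ (d - p - 1))%:E.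
  by move=> _; rewrite lee_fin mulr_ge0 ?powR_ge0// ltW.
rewrite ge0_integralZl//; last exact: mq.
by rewrite -[leRHS]mule1 lee_wpmul2l ?lee_fin// integral_powR_le.
Qed.

End riesz_energy_bounds.

(** * Dominated convergence and the lower limit of the capacity *)

Section capacity_liminf.
Context (R : realType) (n : nat).
Local Notation T := (borel_Rn R n).
Variables (P : probability T R) (A : set T) (C d tau : R).
Hypotheses (mA : measurable A) (PA : P A = 1%E) (C0 : 0 <= C).
Hypothesis PC : forall x r, A x -> 0 < r < 1 ->
  (P (oball x r) <= (C * r `^ d)%:E)%E.
Hypothesis null_exceptions : forall B : set T, measurable B ->
  B `<=` [set x | A x /\ ~ has_second_order_density d P x tau] -> P B = 0%E.

Let scaled (p : R) (x : T) : \bar R := ((d - p)%:E * truncated_potential P p x)%E.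

Let scaled_ge0 p x : p <= d -> (0 <= scaled p x)%E.
Proof.
by move=> pd; rewrite mule_ge0 ?truncated_potential_ge0// lee_fin subr_ge0.
Qed.

Let scaled_le p x : p < d -> A x -> (scaled p x <= C%:E)%E.
Proof. by move=> pd Ax; apply: truncated_potential_le => // r; exact: PC. Qed.

Let measurable_scaled p (D : set T) : measurable_fun D (scaled p).
Proof.
apply: measurable_funTS; apply: measurable_funeM.
exact: measurable_truncated_potential.
Qed.

(* The exceptional set need not be Borel; along a sequence it contains the
   Borel set where the upper limit of [`|scaled - tau|] does not vanish. *)
Lemma cvg_integral_scaled_potential (u : R^nat) : (forall k, u k < d) ->
  u @ \oo --> d ->
  (\int[P]_(x in A) scaled (u k) x)%E @[k --> \oo] --> tau%:E.
Proof.
move=> ud uc; pose v k x := `|scaled (u k) x - tau%:E|%E.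
have mv k : measurable_fun [set: T] (v k).
  apply: measurableT_comp => //; apply: emeasurable_funB => //.
have mls : measurable_fun [set: T] (fun x => limn_esup (v ^~ x)).
  exact: measurable_fun_limn_esup.
pose B := A `&` ((fun x => limn_esup (v ^~ x)) @^-1` ~` [set 0%E]).
have mB : measurable B.
  apply: measurableI => //; rewrite -[X in measurable X]setTI.
  by apply: mls => //; exact: measurableC.
have u_left : u k @[k --> \oo] --> d^'-.
  move=> W [r /= r0 rW]; move/cvgrPdist_lt : uc => /(_ _ r0).
  by apply: filterS => k uk; exact: rW.
have PB : P B = 0%E.
  apply: null_exceptions => // x [Ax xB]; split=> // dens; apply: xB => /=.
  have : (fun k => scaled (u k) x) @ \oo --> tau%:E.
    exact: (cvg_comp _ _ u_left dens).
  move=> sc; have sc0 : (fun k => v k x) @ \oo --> 0%E.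
    by apply/(cvg_abse0P (fun k => scaled (u k) x - tau%:E)%E)/sube_cvg0.
  by case: (cvg_limn_einf_sup sc0).
have -> : tau%:E = (\int[P]_(x in A) (cst tau%:E) x)%E.
  by rewrite (integral_cst P mA) [X in (_ * X)%E]PA mule1.
have [|||||_ _] := @dominated_convergence _ _ _ P A mA
  (fun k => scaled (u k)) (cst tau%:E) (cst C%:E); last exact.
- by move=> k; exact: measurable_scaled.
- exact: measurable_cst.
- exists B; split => // x /=; rewrite /B/= => xB.
  have Ax : A x by apply: contrapT => nA; apply: xB => /nA.
  split => // ls0; apply: xB => _; apply/sube_cvg0 => //.
  apply/(cvg_abse0P (fun k => scaled (u k) x - tau%:E)%E).
  have lev k : (0 <= v k x)%E by exact: abse_ge0.
  by apply: (limn_esup_le_cvg _ lev); rewrite ls0.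
- exact: finite_measure_integrable_cst.
- apply: aeW => x k Ax /=; rewrite gee0_abs ?scaled_ge0 ?(ltW (ud k))//.
  exact: scaled_le.
Qed.

Let mean p : R := fine (\int[P]_(x in A) scaled p x)%E.

Let integral_scaled_fin p : p < d ->
  (\int[P]_(x in A) scaled p x)%E \is a fin_num.
Proof.
move=> pd; rewrite ge0_fin_numE; last first.
  by apply: integral_ge0 => x _; rewrite scaled_ge0// ltW.
apply: (@le_lt_trans _ _ (\int[P]_(x in A) (cst C%:E) x)%E).
  apply: ge0_le_integral => //.
  - by move=> x _; rewrite scaled_ge0// ltW.
  - by move=> x Ax; exact: scaled_le.
by rewrite (integral_cst P mA) [X in (_ * X)%E]PA mule1 ltry.
Qed.

(** A left limit can be tested along sequences below [d], where dominated convergence applies. *)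
Lemma cvg_mean : mean p @[p --> d^'-] --> tau.
Proof.
apply/cvg_at_leftP => u [ud uc]; apply: fine_cvg.
exact: cvg_integral_scaled_potential.
Qed.

Hypotheses (d0 : 0 < d) (tau0 : 0 < tau) (D : R) (D0 : 0 < D).
Hypothesis AD : forall x y : 'cV[R]_n, A x -> A y -> edist x y <= D.

(** The [p]-th power of the capacity is the inverse of the energy; multiply the upper bound on the
    energy by [d - p] and invert. *)
Lemma riesz_capacity_ge p : 0 < p < d ->
  ((d - p) + p * mean p)^-1 <= riesz_capacity p A `^ p / (d - p).
Proof.
move=> /andP[p0 pd]; have q0 : 0 < d - p by rewrite subr_gt0.
have Vge := riesz_energy_ge mA p0 D0 AD.
have Vle := riesz_energy_le mA PA p0.
have IE : (\int[P]_(x in A) truncated_potential P p x = ((d - p)^-1 * mean p)%:E)%E.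
  rewrite EFinM fineK ?integral_scaled_fin// ge0_integralZl//; last 3 first.
  - by apply: measurable_funTS; exact: measurable_truncated_potential.
  - by move=> x _; exact: truncated_potential_ge0.
  - by rewrite lee_fin ltW.
  by rewrite muleA -EFinM mulVf ?gt_eqF// mul1e.
move: Vge Vle; rewrite IE -EFinM -EFinD /riesz_capacity.
(* The two bounds leave only a finite energy [v]. *)
case: (riesz_energy p A) => //= v; rewrite !lee_fin => Dv vle.
have v0 : 0 < v by apply: lt_le_trans Dv; exact: powR_gt0.
rewrite -powRrM mulNr mulVf ?gt_eqF// powR_inv1 ?(ltW v0)// -invfM.
have vd0 : 0 < v * (d - p) by rewrite mulr_gt0.
have vd : v * (d - p) <= (d - p) + p * mean p.
  rewrite -ler_pdivlMr//; apply: le_trans vle _.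
  by rewrite le_eqVlt; apply/orP; left; apply/eqP; field; rewrite gt_eqF.
by rewrite lef_pV2 ?posrE// (lt_le_trans vd0).
Qed.

Lemma riesz_capacity_liminf :
  (((d * tau)^-1)%:E <=
   limf_einf (fun p : R => (riesz_capacity p A `^ p / (d - p))%:E) d^'-)%E.
Proof.
have cv : ((d - p) + p * mean p)^-1 @[p --> d^'-] --> (d * tau)^-1.
  apply: cvgV; first by rewrite gt_eqF// mulr_gt0.
  rewrite -[d * tau]add0r -[X in _ --> X + _](subrr d).
  have idc : p @[p --> d^'-] --> d by apply: cvg_at_left_filter; exact: cvg_id.
  apply: cvgD; first by apply: cvgB => //; exact: cvg_cst.
  by apply: cvgM => //; exact: cvg_mean.
rewrite limf_einfE; apply/lee_addgt0Pr => e e0.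
rewrite -leeBlDr// -EFinB.
(* The lower limit is a supremum of infima over neighbourhoods; [W] contains a left neighbourhood of
   [d] by the convergence [cv]. *)
pose W := [set p : R | (d * tau)^-1 - e <= riesz_capacity p A `^ p / (d - p)].
apply: (@le_trans _ _ (ereal_inf ((fun p : R =>
    (riesz_capacity p A `^ p / (d - p))%:E) @` W))).
  by apply: le_ereal_inf_tmp => _ [p Wp <-]; rewrite lee_fin.
apply: ereal_sup_ubound; exists W => //.
move/cvgrPdist_le : cv => /(_ _ e0) cv.
near=> p; rewrite /W/=.
have pd : 0 < p < d by apply/andP; split; near: p;
  [exact: nbhs_left_gt|exact: nbhs_left_lt].
apply: le_trans (riesz_capacity_ge pd).
rewrite lerBlDl -lerBlDr.
have : `|(d * tau)^-1 - (d - p + p * mean p)^-1| <= e by near: p.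
by apply: le_trans; exact: ler_norm.
Unshelve. all: by end_near. Qed.

End capacity_liminf.

(** * Application to self-similar sets *)

Lemma has_second_order_density_scale (R : realType) (n : nat) (d c sigma : R)
    (P : probability (borel_Rn R n) R) (nu : set 'cV[R]_n -> \bar R) x :
  0 < c -> (forall E, P E = c%:E * nu E)%E ->
  has_second_order_density d nu x sigma ->
  has_second_order_density d P x (c * sigma).
Proof.
move=> c0 Pnu; rewrite /has_second_order_density EFinM.
(* Pulling the constant out of the integral requires measurability, which is available for [P];
   hence [nu] is rewritten in terms of [P]. *)
have nuP E : nu E = (c^-1%:E * P E)%E.
  by rewrite Pnu muleA -EFinM mulVf ?mul1e// gt_eqF.
have intE p : (\int[@lebesgue_measure R]_(r in `]0%R, 1%R[)
      (P (oball x r) * (r `^ (- p - 1))%:E) =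
    c%:E * \int[@lebesgue_measure R]_(r in `]0%R, 1%R[)
      (nu (oball x r) * (r `^ (- p - 1))%:E))%E.
  under [in RHS]eq_integral do rewrite nuP -muleA.
  rewrite ge0_integralZl//.
  - by rewrite muleA -EFinM divff ?mul1e// gt_eqF.
  - exact: measurable_truncated_integrand.
  - by move=> r _; rewrite mule_ge0// lee_fin powR_ge0.
  - by rewrite lee_fin invr_ge0 ltW.
move=> nud; under eq_fun do rewrite intE muleCA.
exact: cvgeZl.
Qed.

(** Settles the case [sigma <= 0] of the final bound. *)
Lemma riesz_capacity_liminf_ge0 (R : realType) (n : nat) (A : set 'cV[R]_n)
    (d : R) :
  (0 <= limf_einf (fun p : R => (riesz_capacity p A `^ p / (d - p))%:E) d^'-)%E.
Proof.
rewrite limf_einfE; pose W := [set p : R | p < d].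
apply: (@le_trans _ _ (ereal_inf ((fun p : R =>
    (riesz_capacity p A `^ p / (d - p))%:E) @` W))).
  apply: le_ereal_inf_tmp => _ [p pd <-].
  by rewrite lee_fin divr_ge0 ?powR_ge0// subr_ge0 ltW.
by apply: ereal_sup_ubound; exists W => //; exact: nbhs_left_lt.
Qed.

Theorem corollary1p7 (R : realType) (n : nat) (A : set 'cV[R]_n) (d sigma : R)
    (hA : strictly_self_similar A)
    (hd : hausdorff_dim A = d%:E)
    (hsigma : is_second_order_density d A sigma) :
  (hausdorff_measure d A * ((d * sigma)^-1)%:E <=
   limf_einf (fun p : R => (riesz_capacity p A `^ p / (d - p))%:E) d^'-)%E.
Proof.
have [N [L [f [e S]]]] := strictly_self_similar_ifs hA.
have [d0 md] := hausdorff_dim_moran S hd.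
have HA0 : (0 < hausdorff_measure d A)%E.
  by apply: (hausdorff_measure_gt0 S); rewrite ?md// ltW.
have HAoo : (hausdorff_measure d A < +oo)%E.
  by apply: (hausdorff_measure_lty S); rewrite ?md// ltW.
(* Positivity of [sigma] is not assumed; for [sigma <= 0] the left-hand side is at most 0, the
   inverse of 0 being 0. *)
have [sigma0|sigma0] := leP sigma 0.
  apply: (le_trans _ (riesz_capacity_liminf_ge0 A d)).
  rewrite mule_ge0_le0 ?(ltW HA0)// lee_fin invr_le0.
  by rewrite mulr_ge0_le0// ltW.
have HAf : hausdorff_measure d A \is a fin_num by rewrite ge0_fin_numE// ltW.
pose M := fine (hausdorff_measure d A).
have M0 : 0 < M by rewrite fine_gt0// HA0.
have [|P PE] := hausdorff_probability S (d := d); first by rewrite HA0.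
have mA : measurable (A : set (borel_Rn R n)).
  apply: measurable_closed_borel; apply: compact_closed (ifs_compact S).
  exact: norm_hausdorff.
have PA : P A = 1%E.
  rewrite PE /hausdorff_restr setIid -[X in (_ * X)%E](fineK HAf) -EFinM.
  by rewrite mulVf// gt_eqF.
have [D D0 AD] := compact_edist_bounded (ifs_compact S).
have e0 := ifs_gap_gt0 S.
have PC x r : A x -> 0 < r < 1 -> (P (oball x r) <= (e^-1 `^ d * r `^ d)%:E)%E.
  move=> Ax /andP[r0 _]; rewrite PE.
  have := hausdorff_measure_oball_le S (ltW d0) Ax r0.
  rewrite -[X in (_ * X)%E](fineK HAf) -/M => H.
  rewrite lee_pdivrMl// (le_trans H)// -EFinM lee_fin mulrC.
  by rewrite ler_wpM2l ?(ltW M0)// -powRM ?invr_ge0 ?(ltW e0) ?(ltW r0)// [e^-1 * r]mulrC.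
have c0 : 0 < M^-1 by rewrite invr_gt0.
have null (B : set (borel_Rn R n)) : measurable B ->
    B `<=` [set x | A x /\ ~ has_second_order_density d P x (M^-1 * sigma)] ->
    P B = 0%E.
  (* For such [B], the part in [A] lies in the exceptional set of [hsigma], because normalization
     multiplies the density by [M^-1]. *)
  move=> mB BN; rewrite PE; apply/eqP; rewrite mule_eq0; apply/orP; right.
  rewrite eq_le hausdorff_measure_ge0 andbT -[leRHS]hsigma.
  apply: le_hausdorff_measure => x [/BN[Ax ndens] _]; split=> // dens.
  exact/ndens/(has_second_order_density_scale c0 PE dens).
have := riesz_capacity_liminf mA PA (powR_ge0 _ _) PC null d0 _ D0 AD.
rewrite mulr_gt0// => /(_ isT); apply: le_trans.
(* The density of [P] is [sigma / M], so its bound [(d * (sigma / M))^-1] equals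
   [M / (d * sigma)]. *)
rewrite -[X in (X * _)%E](fineK HAf) -/M -EFinM lee_fin.
by rewrite le_eqVlt; apply/orP; left; apply/eqP; field; rewrite !gt_eqF.
Qed.
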